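(* Let $u_1,\dots,u_s$ be distinct complex numbers and $\alpha_1,\dots,\alpha_s$ complex numbers. Then the sequence $a_n=\Gamma(n-u_1)^{\alpha_1}\cdots\Gamma(n-u_s)^{\alpha_s}$, defined for $n\ge n_0:=\lfloor\max_i\Re(u_i)\rfloor+1$, is holonomic if and only if $\alpha_1,\dots,\alpha_s$ are all integers.
   Context: $\Gamma$ is Euler's Gamma function. A sequence $(a_n)_{n\ge n_0}$ is holonomic if there exist polynomials $p_0,\dots,p_d\in\mathbb{C}[x]$, not all zero, such that $p_0(n)a_n+p_1(n)a_{n+1}+\dots+p_d(n)a_{n+d}=0$ for all sufficiently large integers $n$. *)

(* Defs.v *)
From mathcomp Require Import all_boot all_order all_algebra.
From mathcomp Require Import complex.
From mathcomp Require Import all_classical all_reals all_analysis.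

Set Implicit Arguments.
Unset Strict Implicit.
Unset Printing Implicit Defensive.

Import Order.TTheory GRing.Theory Num.Theory.
Import numFieldNormedType.Exports.
Import ComplexField.Normc.

Local Open Scope classical_set_scope.
Local Open Scope ring_scope.
Local Open Scope complex_scope.

Section ComplexFunctions.
Variable R : realType.
Implicit Types z w : R[i].

Definition cexp z : R[i] :=
  (expR (complex.Re z))%:C * (cos (complex.Im z) +i* sin (complex.Im z)).

(* Principal argument of z != 0, with values in ]-pi, pi]. *)
Definition carg z : R :=
  let t := acos (complex.Re z / normc z) in
  if 0 <= complex.Im z then t else - t.

(* Principal logarithm of z != 0. *)
Definition clog z : R[i] := ln (normc z) +i* carg z.

(* Principal value of z ^ w; at z = 0 the convention is that of powR. *)
Definition cpow z w : R[i] :=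
  if z == 0 then (w == 0)%:R else cexp (w * clog z).

(* Euler's limit m! m^z / (z (z + 1) ... (z + m)), valid for every z which is
   not a nonpositive integer. *)
Definition Gamma z : R[i] :=
  lim ((m`!%:R * cpow m%:R z / \prod_(j < m.+1) (z + j%:R) : R[i]^o)
        @[m --> \oo]).

(* The sequence (a_n)_{n >= n0} is represented by a total function on int whose
   values below n0 are never used. *)
Definition holonomic (n0 : int) (a : int -> R[i]) : Prop :=
  exists (d : nat) (p : 'I_d.+1 -> {poly R[i]}),
    (exists k, p k != 0) /\
    exists N : int, n0 <= N /\
      forall n : int, N <= n ->
        \sum_(k < d.+1) (p k).[n%:~R] * a (n + k%:Z) = 0.

End ComplexFunctions.

(* Main.v *)
(** A shift of index multiplies [a_n] by the product of the [(n - u_i)^alpha_i],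
    up to factors [exp (2 i pi alpha_j)] produced when [Gamma (n - u_j)] crosses
    the cut of the principal logarithm.  Since [arg (n - u_j)] tends to [0] with a
    constant sign, two crossings for the same [j] are far apart, so arbitrarily far
    there are windows of any prescribed length without crossings.  In such a
    window a holonomic recurrence says that
      [F(x) = sum_k p_k(x) prod_(j < k) prod_i (x + j - u_i)^alpha_i]
    vanishes at many consecutive integers.  The [r] nonzero terms of [F] have
    logarithmic derivatives that are rational and [O(1/x)].  If no two of them
    differ by the logarithmic derivative of a rational function, then [F] solves
    a linear differential equation of order [r], with coefficients tending to
    [0], for which [r] consecutive zeros far out force [F, F', ..., F^(r-1)] to
    vanish simultaneously, whereas these jets do not vanish near infinity.  Hence
    for some [l < k] all residues of
      [sum_(l <= j < k) sum_i alpha_i / (x + j - u_i)]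
    are integers.  Differences of residues at neighbouring points show that the
    exponent at [w] is congruent modulo 1 to the exponent at [w + (k - l)], thus
    to [0], because far enough to the right there are no [u_i]. *)

Require Import Defs.
From mathcomp Require Import all_boot all_order all_algebra.
From mathcomp Require Import complex.
From mathcomp Require Import ring lra zify.
From mathcomp Require Import all_classical all_reals all_analysis.

Set Implicit Arguments.
Unset Strict Implicit.
Unset Printing Implicit Defensive.

Import Order.TTheory GRing.Theory Num.Theory.
Import numFieldNormedType.Exports.
Import ComplexField.Normc.

Local Open Scope classical_set_scope.
Local Open Scope ring_scope.
Local Open Scope complex_scope.

Local Notation Re := complex.Re.
Local Notation Im := complex.Im.

(** * The complex exponential, the principal logarithm and complex powers *)

Section ComplexExponential.
Variable R : realType.
Implicit Types (z w : R[i]) (x y : R).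

Lemma complex_ext z w : Re z = Re w -> Im z = Im w -> z = w.
Proof. by case: z w => [a b] [c d] /= -> ->. Qed.

Lemma Re_add z w : Re (z + w) = Re z + Re w.
Proof. by case: z w => [a b] [c d]. Qed.

Lemma Im_add z w : Im (z + w) = Im z + Im w.
Proof. by case: z w => [a b] [c d]. Qed.

Lemma Re_opp z : Re (- z) = - Re z.
Proof. by case: z. Qed.

Lemma Im_opp z : Im (- z) = - Im z.
Proof. by case: z. Qed.

Lemma Re_mul z w : Re (z * w) = Re z * Re w - Im z * Im w.
Proof. by case: z w => [a b] [c d]. Qed.

Lemma Im_mul z w : Im (z * w) = Re z * Im w + Im z * Re w.
Proof. by case: z w => [a b] [c d]. Qed.

Lemma Re_nat n : Re (n%:R : R[i]) = n%:R.
Proof. by elim: n => // n IH; rewrite -!natr1 Re_add IH. Qed.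

Lemma Im_nat n : Im (n%:R : R[i]) = 0.
Proof. by elim: n => // n IH; rewrite -!natr1 Im_add IH addr0. Qed.

Lemma nat_complex n : (n%:R : R[i]) = (n%:R : R)%:C.
Proof. by apply: complex_ext; rewrite ?Re_nat ?Im_nat. Qed.

Lemma int_complex (n : int) : (n%:~R : R[i]) = (n%:~R : R)%:C.
Proof.
case: n => n; rewrite ?NegzE ?mulrNz -?pmulrn nat_complex //.
by apply: complex_ext => //=; rewrite oppr0.
Qed.

Lemma normc_re_im z : normc z = Num.sqrt (Re z ^+ 2 + Im z ^+ 2).
Proof. by case: z. Qed.

Lemma normc_gt0 z : z != 0 -> 0 < normc z.
Proof.
move=> z0; rewrite lt_def normc_re_im sqrtr_ge0 andbT -normc_re_im.
by apply: contra z0 => /eqP/eq0_normc ->.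
Qed.

Lemma sqr_normcE z : normc z ^+ 2 = Re z ^+ 2 + Im z ^+ 2.
Proof. by rewrite normc_re_im sqr_sqrtr // addr_ge0 // sqr_ge0. Qed.

Lemma cexpE z :
  cexp z = (expR (Re z) * cos (Im z)) +i* (expR (Re z) * sin (Im z)).
Proof. by rewrite /cexp; simpc. Qed.

Lemma cexpD z w : cexp (z + w) = cexp z * cexp w.
Proof.
rewrite !cexpE; apply: complex_ext;
by rewrite /= Re_add Im_add expRD ?cosD ?sinD; ring.
Qed.

Lemma cexp0 : cexp (0 : R[i]) = 1.
Proof. by rewrite cexpE /= expR0 cos0 sin0 mulr1 mulr0. Qed.

Lemma cexp_neq0 z : cexp z != 0.
Proof.
apply/eqP => e0; have := cexpD z (- z).
by rewrite subrr e0 mul0r cexp0 => /eqP; rewrite oner_eq0.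
Qed.

Lemma cexpN z : cexp (- z) = (cexp z)^-1.
Proof.
apply: (mulfI (cexp_neq0 z)).
by rewrite -cexpD subrr cexp0 mulfV // cexp_neq0.
Qed.

Lemma cexp_natmul n z : cexp (n%:R * z) = cexp z ^+ n.
Proof.
elim: n => [|n IH]; first by rewrite mul0r cexp0 expr0.
by rewrite -natr1 mulrDl mul1r cexpD IH exprSr.
Qed.

Lemma cexp_sum (I : Type) (r : seq I) (P : pred I) (F : I -> R[i]) :
  cexp (\sum_(i <- r | P i) F i) = \prod_(i <- r | P i) cexp (F i).
Proof.
by apply: (big_morph _ cexpD cexp0).
Qed.

Lemma cexp_period z : cexp (z + (0 +i* (pi *+ 2))) = cexp z.
Proof. by rewrite cexpD [X in _ * X]cexpE /= expR0 cos2pi sin2pi mulr1 mulr0 mulr1. Qed.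

Lemma cexp_periodN z : cexp (z - (0 +i* (pi *+ 2))) = cexp z.
Proof. by rewrite -[in RHS](subrK (0 +i* (pi *+ 2)) z) cexp_period. Qed.

Lemma Re_div_normc_bound z : z != 0 -> -1 <= Re z / normc z <= 1.
Proof.
move=> z0; have n0 := normc_gt0 z0.
rewrite -ler_norml normrM [`|(normc z)^-1|]gtr0_norm ?invr_gt0 //.
rewrite ler_pdivrMr // mul1r -[leRHS]gtr0_norm // -ler_sqr ?nnegrE //.
rewrite !real_normK ?num_real // sqr_normcE.
by rewrite lerDl sqr_ge0.
Qed.

Lemma carg_bound z : z != 0 -> - pi < carg z <= pi.
Proof.
move=> z0; have hb := Re_div_normc_bound z0; rewrite /carg.
case: ifPn => [i0|]; last rewrite -ltNge => i0.
  by rewrite acos_lepi // (lt_le_trans _ (acos_ge0 hb)) // oppr_lt0 pi_gt0.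
rewrite ltrN2; apply/andP; split; last first.
  by rewrite (le_trans _ (pi_ge0 R)) // oppr_le0 acos_ge0.
(* The value [- pi] would force [Re z = - normc z], hence [Im z = 0], whereas here [Im z < 0]. *)
apply: acos_ltpi; case/andP: hb => h1 ->; rewrite andbT lt_neqAle h1 andbT.
apply/eqP => h.
have n0 := normc_gt0 z0.
have : Re z = - normc z by rewrite -[Re z](mulfVK (lt0r_neq0 n0)) -h mulN1r.
move=> h2; have := sqr_normcE z; rewrite h2 sqrrN => /eqP.
by rewrite eq_sym -subr_eq0 addrC addKr sqrf_eq0 lt_eqF.
Qed.

Lemma cexp_clog z : z != 0 -> cexp (clog z) = z.
Proof.
move=> z0; have n0 := normc_gt0 z0; have hb := Re_div_normc_bound z0.
rewrite cexpE /clog /= lnK ?posrE //.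
have hc : cos (carg z) = Re z / normc z.
  rewrite /carg; case: ifP => _; rewrite ?cosN acosK //.
have hs : sin (carg z) = Im z / normc z.
  have e : sin (acos (Re z / normc z)) = `|Im z| / normc z.
    rewrite sin_acos //.
    have -> : 1 - (Re z / normc z) ^+ 2 = (Im z / normc z) ^+ 2.
      rewrite !expr_div_n sqr_normcE.
      have : Re z ^+ 2 + Im z ^+ 2 != 0 by rewrite -sqr_normcE expf_neq0 // lt0r_neq0.
      by move=> h; field.
    rewrite sqrtr_sqr normrM normfV (gtr0_norm n0) //.
  rewrite /carg; case: ifPn => [i0|]; last rewrite -ltNge => i0.
    by rewrite e ger0_norm.
  by rewrite sinN e ltr0_norm // mulNr opprK.
by apply: complex_ext => /=; rewrite ?hc ?hs mulrC divfK // lt0r_neq0.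
Qed.

Lemma clog_cexp z : - pi < Im z <= pi -> clog (cexp z) = z.
Proof.
move=> /andP[h1 h2].
have ne : normc (cexp z) = expR (Re z).
  rewrite cexpE normc_re_im /= !exprMn -mulrDr cos2Dsin2 mulr1 sqrtr_sqr.
  by rewrite ger0_norm // expR_ge0.
rewrite /clog ne expRK; apply: complex_ext => //=.
rewrite /carg ne cexpE /= mulrAC divff ?mul1r; last by rewrite gt_eqF ?expR_gt0.
rewrite pmulr_rge0 ?expR_gt0 //.
case: (leP 0 (Im z)) => i0.
  by rewrite sin_ge0_pi ?i0 // cosK // in_itv /= i0.
have : sin (Im z) < 0.
  by rewrite -oppr_gt0 -sinN sin_gt0_pi // oppr_gt0 i0 /= ltrNl.
by rewrite ltNge => /negbTE ->; rewrite cosKN ?opprK // !ltW.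
Qed.

(** The arctangent lies in ]-pi/2, pi/2[, has cosine [Re z / normc z] and has the sign of [Im z].
    Unlike [acos], it can be differentiated and estimated across the positive real axis. *)
Lemma carg_atan z : 0 < Re z -> carg z = atan (Im z / Re z).
Proof.
move=> r0; have z0 : z != 0 by apply/eqP => e; rewrite e /= ltxx in r0.
have n0 := normc_gt0 z0.
set t := atan _.
have tb1 : - (pi / 2) < t by exact: atan_gtNpi2.
have tb2 : t < pi / 2 by exact: atan_ltpi2.
have p0 := pi_gt0 R.
have tcos : cos t = Re z / normc z.
  rewrite cos_atan normc_re_im.
  have -> : 1 + (Im z / Re z) ^+ 2 = (Re z ^+ 2 + Im z ^+ 2) / Re z ^+ 2.
    by field; rewrite gt_eqF.
  rewrite sqrtrM ?addr_ge0 ?sqr_ge0 // sqrtrV ?sqr_ge0 // sqrtr_sqr gtr0_norm //.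
  by rewrite invfM invrK mulrC.
rewrite /carg -tcos; case: ifPn => i0; last rewrite -ltNge in i0.
  rewrite cosK // in_itv /=; apply/andP; split; last by lra.
  by rewrite -[0]atan0 le_atan // divr_ge0 // ltW.
rewrite cosKN ?opprK //; apply/andP; split; first by lra.
by rewrite -[0]atan0 le_atan // pmulr_lle0 ?invr_gt0 // ltW.
Qed.

Lemma clog_mul z w : z != 0 -> w != 0 -> - pi < carg z + carg w <= pi ->
  clog (z * w) = clog z + clog w.
Proof.
by move=> z0 w0 h; rewrite -{1}(cexp_clog z0) -{1}(cexp_clog w0) -cexpD clog_cexp.
Qed.

(** Both arguments are at most [pi], so a single period brings their sum back into the strip where
    [clog] inverts [cexp]. *)
Lemma carg_mul_wrap z w : z != 0 -> w != 0 -> pi < carg z + carg w ->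
  carg (z * w) = carg z + carg w - pi *+ 2.
Proof.
move=> z0 w0 h.
have /andP[_ z1] := carg_bound z0; have /andP[_ w1] := carg_bound w0.
have := cexp_periodN (clog z + clog w).
rewrite [in RHS]cexpD !cexp_clog // => e.
have : clog (z * w) = clog z + clog w - (0 +i* (pi *+ 2)).
  have p0 := pi_gt0 R.
  by rewrite -e clog_cexp // !Im_add Im_opp /=; apply/andP; split; lra.
by move/(congr1 (@complex.Im R)); rewrite !Im_add Im_opp.
Qed.

Lemma carg_mul_wrapN z w : z != 0 -> w != 0 -> carg z + carg w <= - pi ->
  carg (z * w) = carg z + carg w + pi *+ 2.
Proof.
move=> z0 w0 h.
have /andP[z1 _] := carg_bound z0; have /andP[w1 _] := carg_bound w0.
have := cexp_period (clog z + clog w).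
rewrite [in RHS]cexpD !cexp_clog // => e.
have : clog (z * w) = clog z + clog w + (0 +i* (pi *+ 2)).
  have p0 := pi_gt0 R.
  by rewrite -e clog_cexp // !Im_add /=; apply/andP; split; lra.
by move/(congr1 (@complex.Im R)); rewrite !Im_add.
Qed.

Lemma cpow_cexp z w : z != 0 -> cpow z w = cexp (w * clog z).
Proof. by rewrite /cpow => /negbTE ->. Qed.

Lemma cpow_int z (m : int) : z != 0 -> cpow z m%:~R = z ^ m.
Proof.
move=> z0; rewrite cpow_cexp //; case: m => n.
  by rewrite -pmulrn cexp_natmul cexp_clog.
by rewrite NegzE mulrNz mulNr cexpN -pmulrn cexp_natmul cexp_clog.
Qed.

Lemma carg_real x : 0 < x -> carg x%:C = 0.
Proof. by move=> x0; rewrite carg_atan //= mul0r atan0. Qed.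

Lemma clog_real x : 0 < x -> clog x%:C = (ln x)%:C.
Proof.
move=> x0; apply: complex_ext => /=; last exact: carg_real.
by rewrite expr0n addr0 sqrtr_sqr gtr0_norm.
Qed.

End ComplexExponential.

(** * Estimates for the convergence of Euler's limit *)

Section GammaFunction.
Variable R : realType.
Implicit Types (z w : R[i]) (x y : R).

Lemma cvg_complex (f : nat -> R[i]) (l : R[i]) :
  Re (f n) @[n --> \oo] --> Re l -> Im (f n) @[n --> \oo] --> Im l ->
  (f n : R[i]^o) @[n --> \oo] --> (l : R[i]^o).
Proof.
move=> hr hi; apply/cvgrPdist_lt => e e0.
have /andP[/eqP /= ei er] : (0 : R[i]) < Re e +i* Im e by case: e e0.
have -> : e = (Re e)%:C by apply: complex_ext.
have er2 : 0 < Re e / 2 by rewrite divr_gt0.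
move/cvgrPdist_lt : hr => /(_ _ er2) hr.
move/cvgrPdist_lt : hi => /(_ _ er2) hi.
near=> n.
rewrite normc_def ltcR Re_add Im_add Re_opp Im_opp.
have h1 : `|Re l - Re (f n)| < Re e / 2 by near: n.
have h2 : `|Im l - Im (f n)| < Re e / 2 by near: n.
rewrite -(@ltr_pXn2r _ 2) ?nnegrE ?sqrtr_ge0 // ?(ltW er) //.
rewrite sqr_sqrtr ?addr_ge0 ?sqr_ge0 //.
rewrite -[(Re l - _) ^+ 2]real_normK ?num_real //.
rewrite -[(Im l - _) ^+ 2]real_normK ?num_real //.
have : `|Re l - Re (f n)| ^+ 2 <= (Re e / 2) ^+ 2 by rewrite ler_sqr ?nnegrE ?(ltW er2) // ltW.
have : `|Im l - Im (f n)| ^+ 2 <= (Re e / 2) ^+ 2 by rewrite ler_sqr ?nnegrE ?(ltW er2) // ltW.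
have : 0 < Re e ^+ 2 by rewrite exprn_gt0.
rewrite expr_div_n; lra.
Unshelve. all: by end_near.
Qed.

(** Subtracting [C / n] makes the sequence nondecreasing and adding it makes the sequence
    nonincreasing, since [C (1/n - 1/(n+1))] dominates each increment. The second sequence bounds
    the first, whose limit is also that of [x]. *)
Lemma cvg_telescoping_bound (x : nat -> R) (C : R) :
  (forall n, `|x n.+2 - x n.+1| <= C * (n.+1%:R^-1 - n.+2%:R^-1)) ->
  cvgn x.
Proof.
move=> h.
have hC : 0 <= C.
  have := le_trans (normr_ge0 _) (h 0%N); rewrite pmulr_lge0 // subr_gt0.
  by rewrite ltf_pV2 ?posrE ?ltr0n // ltr_nat.
pose y n := x n.+1 - C * n.+1%:R^-1.
pose w n := x n.+1 + C * n.+1%:R^-1.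
have yi : nondecreasing_seq y.
  apply/nondecreasing_seqP => n; rewrite /y.
  have := h n; rewrite ler_norml mulrBr => /andP[].
  move: (C * n.+1%:R^-1) (C * n.+2%:R^-1) => p q; lra.
have wi : nonincreasing_seq w.
  apply/nonincreasing_seqP => n; rewrite /w.
  have := h n; rewrite ler_norml mulrBr => /andP[].
  move: (C * n.+1%:R^-1) (C * n.+2%:R^-1) => p q; lra.
have yc : cvgn y.
  apply: nondecreasing_is_cvgn => //; exists (w 0%N) => _ [n _ <-].
  apply: (@le_trans _ _ (w n)); last exact: wi.
  rewrite /y /w; have : 0 <= C * n.+1%:R^-1 by rewrite mulr_ge0 // invr_ge0.
  move: (C * n.+1%:R^-1) => p; lra.
apply/cvg_ex; exists (limn y + C * 0); rewrite -cvg_shiftS.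
have -> : [sequence x n.+1]_n = (fun n => y n + C * harmonic n).
  by apply/funext => n; rewrite /y /harmonic /=; ring.
by apply: cvgD => //; apply: cvgM; [exact: cvg_cst | exact: cvg_harmonic].
Qed.

(** By the mean value theorem [atan x - x = - x c^2 / (1 + c^2)] with [0 < c < x], and
    [c^2 / (1 + c^2) <= c]; oddness handles [x < 0]. *)
Lemma atan_sub_bound x : `|atan x - x| <= x ^+ 2.
Proof.
wlog x0 : x / 0 < x => [hw|].
  have [x0|x0|<-] := ltgtP 0 x; first exact: hw.
    by have := hw (- x); rewrite atanN sqrrN -opprD normrN oppr_gt0; apply.
  by rewrite atan0 subrr normr0 expr0n.
have [|c /[!in_itv]/= /andP[c0 cx]] := @MVT R atan (fun y => (1 + y ^+ 2)^-1) 0 x x0.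
  by apply: continuous_subspaceT => y; exact: continuous_atan.
rewrite atan0 !subr0 => ->.
have c2 : 0 < 1 + c ^+ 2 by rewrite ltr_wpDr ?sqr_ge0.
have -> : (1 + c ^+ 2)^-1 * x - x = - (x * (c ^+ 2 / (1 + c ^+ 2))).
  by field; rewrite gt_eqF.
rewrite normrN normrM gtr0_norm // expr2 ler_pM2l // ger0_norm; last first.
  by rewrite divr_ge0 ?sqr_ge0 // ltW.
rewrite ler_pdivrMr //.
have : c <= x * (1 + 0) by lra.
have : 0 <= x * c ^+ 2 by rewrite mulr_ge0 ?sqr_ge0 // ltW.
have : c ^+ 2 <= c * (1 + c^+2).
  have : 0 <= (c - c^+2)^+2 * c^-1 by rewrite mulr_ge0 ?sqr_ge0 // invr_ge0 ltW.
  have -> : (c - c ^+ 2) ^+ 2 * c^-1 = c - 2 * c^+2 + c ^+ 3 by field; rewrite gt_eqF.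
  have : 0 <= c ^+ 3 by rewrite exprn_ge0 // ltW.
  have -> : c * (1 + c ^+ 2) = c + c ^+ 3 by ring.
  lra.
have : c * (1 + c ^+ 2) <= x * (1 + c ^+ 2) by rewrite ler_pM2r // ltW.
lra.
Qed.

Lemma ln_ge1V x : 0 < x -> 1 - x^-1 <= ln x.
Proof.
move=> x0; have : ln (1 + (x^-1 - 1)) <= x^-1 - 1.
  by apply: le_ln1Dx; rewrite -subr_gt0 opprK subrK invr_gt0.
rewrite addrC subrK lnV ?posrE //; lra.
Qed.

Lemma ln_le_subr1 x : 0 < x -> ln x <= x - 1.
Proof.
by move=> x0; have := @le_ln1Dx R (x - 1); rewrite addrCA subrr addr0; apply; lra.
Qed.

Lemma ln_ratio_bound (m : R) : 0 < m -> (m + 1)^-1 <= ln (m + 1) - ln m <= m^-1.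
Proof.
move=> m0.
have m1 : 0 < m + 1 by lra.
have r0 : 0 < (m + 1) / m by rewrite divr_gt0.
rewrite -ln_div ?posrE //; apply/andP; split.
  apply: le_trans (ln_ge1V r0); rewrite invf_div.
  by have -> : 1 - m / (m + 1) = (m + 1)^-1 by field; rewrite gt_eqF.
apply: le_trans (ln_le_subr1 r0) _.
by have -> : (m + 1) / m - 1 = m^-1 by field; rewrite gt_eqF.
Qed.

Lemma ln_normc z : z != 0 -> ln (normc z) = ln (Re z ^+ 2 + Im z ^+ 2) / 2.
Proof.
move=> z0; rewrite -sqr_normcE lnXn ?normc_gt0 // mulr2n; lra.
Qed.

(* The increment of [log (m! m^z / (z ... (z + m)))], with [m = n.+1]. *)
Definition log_gamma_step (n : nat) z : R[i] :=
  let m : R := n.+1%:R in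
  (ln (m + 1))%:C + z * (ln (m + 1) - ln m)%:C - clog (z + (m + 1)%:C).

(** With [m = n.+1] and [N = m + 1], the first-order parts of [z (ln N - ln m)] and of
    [clog (z + N) - ln N], both about [z / N], cancel. The remainder is of the order of
    [1 / (m N) = 1/m - 1/N], which telescopes. *)
Lemma log_gamma_step_bound z : 0 < Re z -> exists C, forall n,
  `|Re (log_gamma_step n z)| <= C * (n.+1%:R^-1 - n.+2%:R^-1) /\
  `|Im (log_gamma_step n z)| <= C * (n.+1%:R^-1 - n.+2%:R^-1).
Proof.
(* In the constant, [a * (a + 1)] serves the real part, [|b| * (a + 1)] the imaginary part, and
   [b ^+ 2] the terms quadratic in [b] of both. *)
case: z => a b a0; rewrite [Re _]/= in a0; exists (a * (a + 1) + `|b| * (a + 1) + b ^+ 2) => n.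
rewrite -[n.+2%:R]natr1.
rewrite /log_gamma_step; set m : R := n.+1%:R.
have m0 : 0 < m by rewrite ltr0n.
have /andP[l1 l2] := ln_ratio_bound m0.
set N := m + 1 in l1 l2 *; have N0 : 0 < N by rewrite /N; lra.
set L := ln N - ln m in l1 l2 *.
have aN : 0 < a + N by lra.
have b0 : 0 <= `|b| by [].
have b2 : 0 <= b ^+ 2 by rewrite sqr_ge0.
set T := m^-1 - N^-1.
have TE : T = (m * N)^-1 by rewrite /T /N; field; rewrite !gt_eqF.
have T0 : 0 < T by rewrite TE invr_gt0 mulr_gt0.
have iN2 : (N ^+ 2)^-1 <= T.
  rewrite TE lef_pV2 ?posrE ?mulr_gt0 ?exprn_gt0 // expr2 ler_pM2r // /N; lra.
have ia : m^-1 - (a + N)^-1 <= (a + 1) * T.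
  have -> : m^-1 - (a + N)^-1 = (a + 1) * (m * (a + N))^-1.
    by rewrite /N; field; rewrite !gt_eqF //; move: aN; rewrite /N; lra.
  rewrite ler_pM2l ?addr_gt0 // TE lef_pV2 ?posrE ?mulr_gt0 // ler_pM2l //; lra.
have ib : (a + N)^-1 <= N^-1 by rewrite lef_pV2 ?posrE //; lra.
have ibb : ((a + N) ^+ 2)^-1 <= T.
  apply: le_trans iN2; rewrite lef_pV2 ?posrE ?exprn_gt0 // ler_sqr ?nnegrE ?(ltW N0) ?(ltW aN) // lerDr ltW //.
have iNm : N^-1 <= m^-1 by rewrite lef_pV2 ?posrE // /N; lra.
have z0 : (a +i* b) + N%:C != 0.
  by apply/eqP => /(congr1 (@complex.Re R)) /= h; lra.
have hln : ln (normc ((a +i* b) + N%:C)) =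
    ln N + ln ((a + N) / N) + ln (1 + (b / (a + N)) ^+ 2) / 2.
  rewrite ln_normc // Re_add Im_add /= addr0.
  have -> : (a + N) ^+ 2 + b ^+ 2 = (a + N) ^+ 2 * (1 + (b / (a + N)) ^+ 2).
    by field; rewrite gt_eqF.
  rewrite lnM ?posrE ?exprn_gt0 //; last by rewrite ltr_wpDr ?sqr_ge0.
  rewrite lnXn // ln_div ?posrE // mulr2n; lra.
have hq1 := ln_ge1V (divr_gt0 aN N0); rewrite invf_div in hq1.
have hq2 := ln_le_subr1 (divr_gt0 aN N0).
have e1 : 1 - N / (a + N) = a * (a + N)^-1 by field; rewrite gt_eqF.
have e2 : (a + N) / N - 1 = a * N^-1 by field; rewrite gt_eqF.
rewrite e1 in hq1; rewrite e2 in hq2.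
have hr0 : 0 < 1 + (b / (a + N)) ^+ 2 by rewrite ltr_wpDr ?sqr_ge0.
have hr1 : 0 <= ln (1 + (b / (a + N)) ^+ 2).
  by apply: ln_ge0; rewrite lerDl sqr_ge0.
have hr2 : ln (1 + (b / (a + N)) ^+ 2) <= b ^+ 2 * T.
  apply: le_trans (ln_le_subr1 hr0) _.
  by rewrite [1 + _]addrC addrK expr_div_n ler_wpM2l.
have aT : a * (m^-1 - (a + N)^-1) <= a * ((a + 1) * T) by rewrite ler_pM2l.
have p1 : 0 <= a * (a + 1) * T.
  by rewrite mulr_ge0 ?(ltW T0) // mulr_ge0 ?(ltW a0) // addr_ge0 ?(ltW a0).
have p2 : 0 <= `|b| * (a + 1) * T.
  by rewrite mulr_ge0 ?(ltW T0) // mulr_ge0 // addr_ge0 ?(ltW a0).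
have p3 : 0 <= b ^+ 2 * T by rewrite mulr_ge0 ?(ltW T0).
rewrite !mulrDl; split.
  rewrite !Re_add Re_opp Re_mul /= -/N hln mulr0 subr0.
  have aL1 : a * N^-1 <= a * L by rewrite ler_pM2l.
  have aL2 : a * L <= a * m^-1 by rewrite ler_pM2l.
  rewrite ler_norml; move: aL1 aL2 aT hq1 hq2 p1 p2 p3 hr1 hr2; clear.
  clearbody L; clearbody T N.
  move: (m^-1) (a + N)^-1 (N^-1) => iM iaN iN aL1 aL2 aT hq1 hq2 p1 p2 p3 hr1 hr2.
  apply/andP; split; lra.
rewrite !Im_add Im_opp Im_mul /= -/N -/L mulr0 add0r add0r.
rewrite carg_atan /= ?addr0 //.
have hat := atan_sub_bound (b / (a + N)).
have h2 : (b / (a + N)) ^+ 2 <= b ^+ 2 * T by rewrite expr_div_n; exact: ler_wpM2l.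
have -> : b * L - atan (b / (a + N)) =
   b * (L - (a + N)^-1) - (atan (b / (a + N)) - b / (a + N)) by ring.
apply: le_trans (ler_normB _ _) _.
have : `|b * (L - (a + N)^-1)| <= `|b| * (a + 1) * T.
  rewrite normrM -mulrA ler_wpM2l //.
  move: l1 l2 ia ib; clear; move: (m^-1) (a + N)^-1 (N^-1) => iM iaN iN l1 l2 ia ib.
  clearbody L; clearbody T N.
  rewrite ger0_norm; lra.
lra.
Qed.

End GammaFunction.

(** * Convergence, nonvanishing and functional equation of Gamma on the right half-plane *)

Section GammaRecurrence.
Variable R : realType.
Implicit Types (z w : R[i]) (x y : R).

Definition gamma_seq z (m : nat) : R[i] :=
  m`!%:R * cpow m%:R z / \prod_(j < m.+1) (z + j%:R).

(** A logarithm of [gamma_seq z n.+1], built from the principal logarithms of the factors: the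
    principal logarithm of the whole quotient could jump by [2 i pi] from one index to the next. *)
Definition log_gamma_seq z (n : nat) : R[i] :=
  (ln (n.+1`!%:R))%:C + z * (ln n.+1%:R)%:C - \sum_(j < n.+2) clog (z + j%:R).

Lemma Re_gt0_addn_neq0 z (n : nat) : 0 < Re z -> z + n%:R != 0.
Proof.
move=> z0; apply/eqP => /(congr1 (@complex.Re R)); rewrite Re_add Re_nat /=.
by apply/eqP; rewrite gt_eqF // ltr_pwDl.
Qed.

Lemma cexp_real x : cexp x%:C = (expR x)%:C.
Proof. by rewrite cexpE /= cos0 sin0 mulr1 mulr0. Qed.

Lemma cexp_log_gamma_seq z n : 0 < Re z ->
  cexp (log_gamma_seq z n) = gamma_seq z n.+1.
Proof.
move=> z0; rewrite /log_gamma_seq /gamma_seq !cexpD cexpN cexp_sum cexp_real.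
rewrite lnK ?posrE ?ltr0n ?fact_gt0 // -nat_complex.
congr (_ * _ / _); last first.
  by apply: eq_bigr => j _; rewrite cexp_clog // Re_gt0_addn_neq0.
by rewrite cpow_cexp ?pnatr_eq0 // nat_complex clog_real.
Qed.

Lemma log_gamma_seqS z n :
  log_gamma_seq z n.+1 - log_gamma_seq z n = log_gamma_step n z.
Proof.
rewrite /log_gamma_seq big_ord_recr [n.+2`!]factS natrM lnM ?posrE ?ltr0n ?fact_gt0 //.
rewrite /log_gamma_step [_ + 1]natr1 -nat_complex rmorphB rmorphD /=; ring.
Qed.

Lemma cvg_cexp (f : nat -> R[i]) (l : R[i]) :
  Re (f n) @[n --> \oo] --> Re l -> Im (f n) @[n --> \oo] --> Im l ->
  (cexp (f n) : R[i]^o) @[n --> \oo] --> (cexp l : R[i]^o).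
Proof.
move=> hr hi; apply: cvg_complex; rewrite cexpE;
  under eq_fun do rewrite cexpE; apply: cvgM.
- by apply: (cvg_comp _ _ hr); exact: continuous_expR.
- by apply: (cvg_comp _ _ hi); exact: continuous_cos.
- by apply: (cvg_comp _ _ hr); exact: continuous_expR.
- by apply: (cvg_comp _ _ hi); exact: continuous_sin.
Qed.

(** Convergence is obtained for logarithms; a limit of the form [cexp l] is at the same time seen to
    be nonzero. *)
Lemma gamma_seq_cvg z : 0 < Re z -> exists l : R[i],
  (gamma_seq z m : R[i]^o) @[m --> \oo] --> (cexp l : R[i]^o).
Proof.
move=> z0; have [C hC] := log_gamma_step_bound z0.
(* The shift [n.-1] fits the bound on increments, which starts at index 1. *)
have /cvg_ex[a ha] : cvgn (fun n => Re (log_gamma_seq z n.-1)).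
  apply: (@cvg_telescoping_bound _ _ C) => n /=.
  by rewrite -Re_opp -Re_add log_gamma_seqS; case: (hC n).
have /cvg_ex[b hb] : cvgn (fun n => Im (log_gamma_seq z n.-1)).
  apply: (@cvg_telescoping_bound _ _ C) => n /=.
  by rewrite -Im_opp -Im_add log_gamma_seqS; case: (hC n).
exists (a +i* b); rewrite -cvg_shiftS.
under eq_fun do rewrite /= -cexp_log_gamma_seq //.
move: ha hb; rewrite -cvg_shiftS -[X in _ -> X -> _]cvg_shiftS /= => ha hb.
exact: cvg_cexp.
Qed.

Lemma Gamma_cvg z : 0 < Re z ->
  (gamma_seq z m : R[i]^o) @[m --> \oo] --> (Gamma z : R[i]^o).
Proof.
by move=> /gamma_seq_cvg[l hl]; rewrite /Gamma (cvg_lim _ hl).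
Qed.

Lemma Gamma_neq0 z : 0 < Re z -> Gamma z != 0.
Proof.
by move=> /gamma_seq_cvg[l hl]; rewrite /Gamma (cvg_lim _ hl) ?cexp_neq0.
Qed.

(** The denominators share all factors except [z + 1 + m.+1] on the left and [z] on the right. The
    former, combined with the extra power of [m.+1], gives the correcting factor, which tends to
    1. *)
Lemma gamma_seqD1 z m : 0 < Re z ->
  gamma_seq (z + 1) m.+1 * (1 + (z + 1) * (m.+1%:R)^-1) = z * gamma_seq z m.+1.
Proof.
move=> z0; rewrite /gamma_seq.
have m0 : (m.+1%:R : R[i]) != 0 by rewrite pnatr_eq0.
have -> : cpow m.+1%:R (z + 1) = cpow m.+1%:R z * m.+1%:R.
  by rewrite !cpow_cexp // mulrDl mul1r cexpD cexp_clog.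
rewrite big_ord_recr /= [in RHS]big_ord_recl /= addr0.
have -> : \prod_(i < m.+1) (z + 1 + i%:R) = \prod_(i < m.+1) (z + (bump 0 i)%:R).
  by apply: eq_bigr => i _; rewrite /bump /= -addrA nat1r.
have p0 : \prod_(i < m.+1) (z + (bump 0 i)%:R) != 0.
  by apply/prodf_neq0 => i _; exact: Re_gt0_addn_neq0.
have z1 : z + 1 + m.+1%:R != 0 by rewrite -addrA nat1r Re_gt0_addn_neq0.
have z2 : z != 0 by have := Re_gt0_addn_neq0 0 z0; rewrite addr0.
have -> : 1 + (z + 1) * m.+1%:R^-1 = (z + 1 + m.+1%:R) / m.+1%:R.
  by rewrite [RHS]mulrDl divff // addrC.
move: p0 z1; set P := \prod_(_ < _) _; set Q := z + 1 + _ => p0 z1.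
by move: m0; set M : R[i] := m.+1%:R => m0; field; rewrite p0 z2 z1 nat1r m0.
Qed.

Lemma cvg_unique_rescaled (K : numFieldType) (f g h : nat -> K) (a b c : K) :
  f @ \oo --> a -> h @ \oo --> (1 : K) -> g @ \oo --> b ->
  (forall m, f m * h m = c * g m) -> a = c * b.
Proof.
move=> fa h1 gb e.
have l1 : (f m * h m) @[m --> \oo] --> a * 1 by exact: cvgM.
have l2 : (f m * h m) @[m --> \oo] --> c * b.
  by under eq_fun do rewrite e; apply: cvgM => //; exact: cvg_cst.
by rewrite mulr1 in l1; rewrite -(cvg_lim _ l1) // (cvg_lim _ l2).
Qed.

Lemma GammaD1 z : 0 < Re z -> Gamma (z + 1) = z * Gamma z.
Proof.
move=> z0.
have z1 : 0 < Re (z + 1) by rewrite Re_add /= ltr_pwDl.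
have h1 : ((1 + (z + 1) * (m.+1%:R)^-1 : R[i]) : R[i]^o) @[m --> \oo] --> (1 : R[i]^o).
  have hh : (fun n : nat => Re ((z + 1) * (n.+1%:R)^-1)) @ \oo --> Re (z + 1) * 0.
    under eq_fun => n.
      have -> : (n.+1%:R : R[i])^-1 = (harmonic n)%:C.
        by rewrite nat_complex /harmonic fmorphV.
      rewrite Re_mul /= mulr0 subr0.
      over.
    by apply: cvgM; [exact: cvg_cst | exact: cvg_harmonic].
  have hi : (fun n : nat => Im ((z + 1) * (n.+1%:R)^-1)) @ \oo --> Im (z + 1) * 0.
    under eq_fun => n.
      have -> : (n.+1%:R : R[i])^-1 = (harmonic n)%:C.
        by rewrite nat_complex /harmonic fmorphV.
      rewrite Im_mul /= mulr0 add0r.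
      over.
    by apply: cvgM; [exact: cvg_cst | exact: cvg_harmonic].
  apply: cvg_complex.
    under eq_fun do rewrite Re_add.
    have := cvgD (cvg_cst (Re (1 : R[i]))) hh; rewrite mulr0 addr0; exact.
  under eq_fun do rewrite Im_add.
  have := cvgD (cvg_cst (Im (1 : R[i]))) hi; rewrite mulr0 addr0; exact.
have h2 : (gamma_seq (z + 1) m.+1 : R[i]^o) @[m --> \oo] --> (Gamma (z + 1) : R[i]^o).
  by have := Gamma_cvg z1; rewrite -cvg_shiftS.
have h3 : (gamma_seq z m.+1 : R[i]^o) @[m --> \oo] --> (Gamma z : R[i]^o).
  by have := Gamma_cvg z0; rewrite -cvg_shiftS.
apply: (cvg_unique_rescaled h2 h1 h3) => m; exact: gamma_seqD1.
Qed.

End GammaRecurrence.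

(** * Differentiation of complex-valued functions of a real variable *)

Section ComplexDerivative.
Variable R : realType.
Implicit Types (f g : R -> R[i]) (x y : R).

(** Taken componentwise along the real line, so that the real mean value and Rolle theorems apply to
    each part. *)
Definition cderiv f x (d : R[i]) : Prop :=
  is_derive x 1 (fun y => Re (f y)) (Re d) /\
  is_derive x 1 (fun y => Im (f y)) (Im d).

(** A total operator, so that it can be iterated freely; its value is meaningful where [cderiv]
    holds. *)
Definition cD f : R -> R[i] :=
  fun x => ('D_1 (fun y => Re (f y)) x) +i* ('D_1 (fun y => Im (f y)) x).

Lemma cderiv_cD f x d : cderiv f x d -> cD f x = d.
Proof.
by case=> h1 h2; apply: complex_ext; rewrite /cD /= derive_val.
Qed.

Lemma cderiv_near f g x d : (\near x, f x = g x) -> cderiv f x d -> cderiv g x d.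
Proof.
move=> fg [h1 h2]; split.
  apply: (near_eq_is_derive _ h1).
  by apply: filterS fg => y ->.
apply: (near_eq_is_derive _ h2).
by apply: filterS fg => y ->.
Qed.

Lemma cderivD f g x df dg : cderiv f x df -> cderiv g x dg ->
  cderiv (fun y => f y + g y) x (df + dg).
Proof.
move=> [f1 f2] [g1 g2]; split.
  by rewrite Re_add; under eq_fun do rewrite Re_add; exact: is_deriveD.
by rewrite Im_add; under eq_fun do rewrite Im_add; exact: is_deriveD.
Qed.

Lemma cderivM f g x df dg : cderiv f x df -> cderiv g x dg ->
  cderiv (fun y => f y * g y) x (df * g x + f x * dg).
Proof.
move=> [f1 f2] [g1 g2]; split.
  under eq_fun do rewrite Re_mul.
  apply: (is_derive_eq (is_deriveB (is_deriveM f1 g1) (is_deriveM f2 g2))).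
  rewrite Re_add !Re_mul /GRing.scale /=; ring.
under eq_fun do rewrite Im_mul.
apply: (is_derive_eq (is_deriveD (is_deriveM f1 g2) (is_deriveM f2 g1))).
rewrite Im_add !Im_mul /GRing.scale /=; ring.
Qed.

Lemma cderiv_cst (c : R[i]) x : cderiv (fun=> c) x 0.
Proof. by split; exact: is_derive_cst. Qed.

Lemma cderiv_id x : cderiv (fun y => y%:C) x 1.
Proof. by split; [exact: is_derive_id | exact: is_derive_cst]. Qed.

Lemma cderiv_eq f x d d' : cderiv f x d -> d = d' -> cderiv f x d'.
Proof. by move=> h <-. Qed.

Lemma cderiv_sum (I : Type) (r : seq I) (f : I -> R -> R[i]) (d : I -> R[i]) x :
  (forall i, cderiv (f i) x (d i)) ->
  cderiv (fun y => \sum_(i <- r) f i y) x (\sum_(i <- r) d i).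
Proof.
move=> h; elim: r => [|a r IH].
  rewrite big_nil; under eq_fun do rewrite big_nil; exact: cderiv_cst.
rewrite big_cons; under eq_fun do rewrite big_cons; exact: cderivD.
Qed.

Lemma cderiv_prod (I : Type) (r : seq I) (f h : I -> R -> R[i]) x :
  (forall i, cderiv (f i) x (h i x * f i x)) ->
  cderiv (fun y => \prod_(i <- r) f i y) x
    ((\sum_(i <- r) h i x) * \prod_(i <- r) f i x).
Proof.
move=> hf; elim: r => [|a r IH].
  by rewrite !big_nil mul0r; under eq_fun do rewrite big_nil; exact: cderiv_cst.
rewrite !big_cons; under eq_fun do rewrite big_cons.
apply: cderiv_eq (cderivM (hf a) IH) _; ring.
Qed.

Lemma cderiv_cexp f x d : cderiv f x d ->
  cderiv (fun y => cexp (f y)) x (d * cexp (f x)).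
Proof.
move=> [h1 h2].
have he : is_derive x 1 (fun y => expR (Re (f y))) (Re d * expR (Re (f x))).
  by apply: (is_derive_eq (is_derive1_comp (is_derive_expR (Re (f x))) h1)); rewrite mulrC.
have hc : is_derive x 1 (fun y => cos (Im (f y))) (Im d * - sin (Im (f x))).
  by apply: (is_derive_eq (is_derive1_comp (is_derive_cos (Im (f x))) h2)); rewrite mulrC.
have hs : is_derive x 1 (fun y => sin (Im (f y))) (Im d * cos (Im (f x))).
  by apply: (is_derive_eq (is_derive1_comp (is_derive_sin (Im (f x))) h2)); rewrite mulrC.
split; under eq_fun do rewrite cexpE.
  apply: (is_derive_eq (is_deriveM he hc)).
  rewrite Re_mul cexpE /GRing.scale /=; ring.
apply: (is_derive_eq (is_deriveM he hs)).
rewrite Im_mul cexpE /GRing.scale /=; ring.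
Qed.

Lemma cderiv_inv f x d : f x != 0 -> cderiv f x d ->
  cderiv (fun y => (f y)^-1) x (- d / f x ^+ 2).
Proof.
move=> fx0 [h1 h2].
have n0 : Re (f x) ^+ 2 + Im (f x) ^+ 2 != 0.
  by rewrite -sqr_normcE expf_neq0 // gt_eqF // normc_gt0.
have hn := is_deriveD (is_deriveM h1 h1) (is_deriveM h2 h2).
have nn : (fun y => Re (f y)) * (fun y => Re (f y)) +
  (fun y => Im (f y)) * (fun y => Im (f y)) = (fun y => Re (f y) ^+ 2 + Im (f y) ^+ 2) by [].
rewrite nn in hn.
have hv := @is_deriveV _ (fun y => Re (f y) ^+ 2 + Im (f y) ^+ 2) x _ _ n0 hn.
have invE (z : R[i]) : z^-1 = (Re z / (Re z ^+ 2 + Im z ^+ 2)) +i*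
    (- (Im z / (Re z ^+ 2 + Im z ^+ 2))) by case: z.
have n4 : (Re (f x) * Re (f x) - Im (f x) * Im (f x)) ^+ 2 +
    (Re (f x) * Im (f x) + Im (f x) * Re (f x)) ^+ 2 != 0.
  apply: contra_neq (expf_neq0 2 n0) => e; rewrite -e; ring.
split; under eq_fun do rewrite invE /=.
  apply: (is_derive_eq (is_deriveM h1 hv)).
  rewrite -exprVn invE Re_mul Re_opp Im_opp /GRing.scale /=.
  by rewrite expr2 Re_mul Im_mul; field; rewrite n4 n0.
apply: (is_derive_eq (is_deriveN (is_deriveM h2 hv))).
rewrite -exprVn invE Im_mul Re_opp Im_opp /GRing.scale /=.
by rewrite expr2 Re_mul Im_mul; field; rewrite n4 n0.
Qed.

(** To the right of [u = a + i b] the cut is avoided, and near [x] the two parts of the logarithm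
    are [ln ((y - a)^2 + b^2) / 2] and [atan (- b / (y - a))]. *)
Lemma cderiv_clog (u : R[i]) x : Re u < x ->
  cderiv (fun y => clog (y%:C - u)) x (x%:C - u)^-1.
Proof.
case: u => a b; rewrite [Re _]/= => ax.
have xa : 0 < x - a by rewrite subr_gt0.
have q0 : 0 < (x - a) ^+ 2 + b ^+ 2 by rewrite ltr_pwDl ?exprn_gt0 ?sqr_ge0.
have h1 : is_derive x 1 (fun y => y - a) 1.
  by apply: (is_derive_eq (is_deriveB (is_derive_id x 1) (is_derive_cst a x 1))); rewrite subr0.
have hq : is_derive x 1 (fun y => (y - a) ^+ 2 + b ^+ 2) (2 * (x - a)).
  apply: (is_derive_eq (is_deriveD (is_deriveM h1 h1) (is_derive_cst (b ^+ 2) x 1))).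
  rewrite /GRing.scale /=; ring.
have nearx : \forall y \near x, a < y by apply: lt_nbhsr.
have re : (x%:C - (a +i* b))^-1 =
  ((x - a) / ((x - a) ^+ 2 + b ^+ 2)) +i* (b / ((x - a) ^+ 2 + b ^+ 2)).
  apply: complex_ext => /=; rewrite ?sub0r sqrrN //.
  by rewrite mulNr opprK.
split; rewrite re /=.
  have hln := @is_derive1_comp _ (@ln R) (fun y => (y - a) ^+ 2 + b ^+ 2) x _ _ (is_derive1_ln q0) hq.
  have h2 := is_deriveZ (2^-1 : R) hln.
  apply: (near_eq_is_derive _ (is_derive_eq h2 _)).
  - near=> y.
    have ya : a < y by near: y.
    rewrite -[RHS]/(ln (normc ((y - a) +i* (0 - b)))) ln_normc /=; last by apply/eqP => -[] /eqP; rewrite subr_eq0 gt_eqF.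
    by rewrite sub0r sqrrN mulrC.
  - rewrite /GRing.scale /=; field; rewrite gt_eqF //.
have hv := @is_deriveV _ (fun y => y - a) x _ _ (lt0r_neq0 xa) h1.
have hz := is_deriveZ (- b) hv.
have hat := @is_derive1_comp _ (@atan R) (fun y => - b * (y - a)^-1) x _ _ (is_derive1_atan _) hz.
apply: (near_eq_is_derive _ (is_derive_eq hat _)).
- near=> y.
  have ya : a < y by near: y.
  by rewrite -[RHS]/(carg ((y - a) +i* (0 - b))) carg_atan /= ?subr_gt0 // sub0r.
rewrite /GRing.scale /=.
field; rewrite !gt_eqF //.
Unshelve. all: by end_near.
Qed.

End ComplexDerivative.

(** * Rational germs at plus infinity *)

Section RationalGerms.
Variable R : realType.
Implicit Types (f g : R -> R[i]) (x y : R) (p q : {poly R[i]}).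

Definition ratfun f := exists p q, q != 0 /\
  \forall x \near +oo_R, f x = p.[x%:C] / q.[x%:C].

(* Rational germs that are [O(1/x)]. *)
Definition small f := exists p q, (size p < size q)%N /\
  \forall x \near +oo_R, f x = p.[x%:C] / q.[x%:C].

Definition ev_derivable f := \forall x \near +oo_R, cderiv f x (cD f x).

Lemma ev_gt (a : R) : \forall x \near +oo_R, a < x.
Proof. by apply: nbhs_pinfty_gt; rewrite num_real. Qed.

Lemma ev_ge (a : R) : \forall x \near +oo_R, a <= x.
Proof. by apply: nbhs_pinfty_ge; rewrite num_real. Qed.

(** Eventual identities thereby hold on a neighbourhood of every far point, and so can be
    differentiated. *)
Lemma near_pinfty_nbhs (P : R -> Prop) :
  (\forall x \near +oo_R, P x) -> \forall x \near +oo_R, \forall y \near x, P y.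
Proof.
move=> [A [Ar hA]]; exists A; split => // x Ax.
by near=> y; apply: hA; near: y; exact: lt_nbhsr.
Unshelve. all: by end_near. Qed.

Lemma ev_cderiv_eq f (d : R -> R[i]) :
  (\forall x \near +oo_R, cderiv f x (d x)) ->
  \forall x \near +oo_R, cD f x = d x.
Proof. by apply: filterS => x; exact: cderiv_cD. Qed.

Lemma ev_derivable_intro f (d : R -> R[i]) :
  (\forall x \near +oo_R, cderiv f x (d x)) -> ev_derivable f.
Proof. by apply: filterS => x h; rewrite (cderiv_cD h). Qed.

Lemma ev_cderiv_ext f g (d : R -> R[i]) :
  (\forall x \near +oo_R, f x = g x) ->
  (\forall x \near +oo_R, cderiv f x (d x)) ->
  \forall x \near +oo_R, cderiv g x (d x).
Proof.
move=> /near_pinfty_nbhs h1 h2; near=> x.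
apply: (@cderiv_near _ f); near: x; assumption.
Unshelve. all: by end_near. Qed.

Lemma ev_derivable_ext f g : (\forall x \near +oo_R, f x = g x) ->
  ev_derivable f -> ev_derivable g.
Proof. by move=> h1 h2; apply: ev_derivable_intro (ev_cderiv_ext h1 h2). Qed.

Lemma cderiv_horner p x : cderiv (fun y => p.[y%:C]) x p^`().[x%:C].
Proof.
elim/poly_ind: p => [|p c IH].
  rewrite deriv0 horner0; under eq_fun do rewrite horner0; exact: cderiv_cst.
rewrite derivD derivM derivX derivC addr0 mulr1.
under eq_fun do rewrite hornerD hornerM hornerX hornerC.
apply: cderiv_eq (cderivD (cderivM IH (cderiv_id x)) (cderiv_cst c x)) _.
by rewrite hornerD hornerM hornerX addr0 mulr1.
Qed.

(** [q] splits into linear factors over [R[i]], and none of them vanishes at a real point to the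
    right of the real parts of all roots. *)
Lemma ev_horner_neq0 q : q != 0 -> \forall x \near +oo_R, q.[x%:C] != 0.
Proof.
move=> q0; have [rs hq] := closed_field_poly_normal q.
have : \forall x \near +oo_R, all (fun r => x%:C - r != 0) rs.
  elim: (rs) => [|r rs' IH] /=; first by near=> x.
  near=> x; apply/andP; split; last by near: x.
  apply/eqP => /(congr1 (@complex.Re R)); rewrite Re_add Re_opp /=.
  by apply/eqP; rewrite gt_eqF // subr_gt0; near: x; exact: ev_gt.
apply: filterS => x /allP hx; rewrite hq hornerZ mulf_neq0 ?lead_coef_eq0 //.
rewrite horner_prod prodf_seq_neq0; apply/allP => r /hx.
by rewrite !hornerE.
Unshelve. all: by end_near. Qed.

Lemma normc_real x : normc x%:C = `|x|.
Proof. by rewrite normc_re_im /= expr0n addr0 sqrtr_sqr. Qed.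

Lemma normc_ge0 (z : R[i]) : 0 <= normc z.
Proof. by rewrite normc_re_im sqrtr_ge0. Qed.

Lemma normc_ge_Re_abs (z : R[i]) : `|Re z| <= normc z.
Proof.
rewrite -ler_sqr ?nnegrE ?normc_ge0 // sqr_normcE real_normK ?num_real //.
by rewrite lerDl sqr_ge0.
Qed.

Lemma normc_ge_Im_abs (z : R[i]) : `|Im z| <= normc z.
Proof.
rewrite -ler_sqr ?nnegrE ?normc_ge0 // sqr_normcE real_normK ?num_real //.
by rewrite lerDr sqr_ge0.
Qed.

Lemma normc_le_ReIm (z : R[i]) : normc z <= `|Re z| + `|Im z|.
Proof.
rewrite -ler_sqr ?nnegrE ?normc_ge0 ?addr_ge0 // sqr_normcE sqrrD.
by rewrite !real_normK ?num_real // addrAC lerDl mulrn_wge0 // mulr_ge0.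
Qed.

Lemma normc_sum (I : Type) (r : seq I) (F : I -> R[i]) :
  normc (\sum_(i <- r) F i) <= \sum_(i <- r) normc (F i).
Proof.
elim/big_ind2 : _ => [|a b c d h1 h2|//]; first by rewrite normc0.
by apply: le_trans (le_normcD _ _) _; exact: lerD.
Qed.

Lemma normc_horner_le p (n : nat) x : (size p <= n.+1)%N -> 1 <= x ->
  normc p.[x%:C] <= (\sum_(i < size p) normc p`_i) * x ^+ n.
Proof.
move=> sp x1; rewrite horner_coef mulr_suml.
apply: le_trans (normc_sum _ _) _; apply: ler_sum => i _.
rewrite normcM -rmorphXn normc_real ger0_norm ?exprn_ge0 ?(le_trans _ x1) //.
rewrite ler_wpM2l ?normc_ge0 // ler_weXn2l //.
by rewrite -ltnS (leq_trans (ltn_ord i)).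
Qed.

(** Each linear factor [x - r] has modulus at least [x / 2] as soon as [x >= 2 Re r]. *)
Lemma normc_horner_ge q : q != 0 -> exists2 c, 0 < c &
  \forall x \near +oo_R, c * x ^+ (size q).-1 <= normc q.[x%:C].
Proof.
move=> q0; have [rs hq] := closed_field_poly_normal q.
have -> : (size q).-1 = size rs.
  by rewrite hq size_scale ?lead_coef_eq0 // size_prod_XsubC.
exists (normc (lead_coef q) * (2^-1) ^+ size rs).
  by rewrite mulr_gt0 ?exprn_gt0 ?invr_gt0 // normc_gt0 // lead_coef_eq0.
have : \forall x \near +oo_R,
    (2^-1 * x) ^+ size rs <= normc (\prod_(r <- rs) ('X - r%:P)).[x%:C].
  elim: (rs) => [|r rs' IH] /=.
    by near=> x; rewrite big_nil hornerC normc1 expr0.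
  near=> x; rewrite big_cons hornerM normcM exprS ler_pM //.
  - rewrite mulr_ge0 ?invr_ge0 //; near: x; exact: ev_ge.
  - rewrite exprn_ge0 // mulr_ge0 ?invr_ge0 //; near: x; exact: ev_ge.
  - rewrite !hornerE; apply: le_trans (normc_ge_Re_abs _).
    rewrite Re_add Re_opp /= (le_trans _ (ler_norm _)) //.
    have : 2 * Re r <= x by near: x; exact: ev_ge.
    lra.
  - near: x; exact: IH.
apply: filterS => x h; rewrite [in leRHS]hq hornerZ normcM -mulrA -exprMn.
by rewrite ler_wpM2l // normc_ge0.
Unshelve. all: by end_near. Qed.

Lemma small_cvg0 f (e : R) : small f -> 0 < e -> \forall x \near +oo_R, normc (f x) <= e.
Proof.
move=> [p [q [spq hf]]] e0.
have q0 : q != 0 by rewrite -size_poly_gt0 (leq_ltn_trans _ spq).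
have [c c0 hq] := normc_horner_ge q0.
have hq0 := ev_horner_neq0 q0.
set K := \sum_(i < size p) normc p`_i.
have K0 : 0 <= K by apply: sumr_ge0 => i _; exact: normc_ge0.
near=> x.
have x1 : 1 <= x by near: x; exact: ev_ge.
have x0 : 0 < x by lra.
have -> : f x = p.[x%:C] / q.[x%:C] by near: x.
have qx : q.[x%:C] != 0 by near: x.
rewrite normcM normcV ler_pdivrMr ?normc_gt0 //.
have hqx : c * x ^+ (size q).-1 <= normc q.[x%:C] by near: x.
case sq : (size q) => [|[|n]]; rewrite ?sq // in spq hqx.
  move: spq; rewrite ltnS leqn0 size_poly_eq0 => /eqP ->.
  by rewrite horner0 normc0 mulr_ge0 ?normc_ge0 // ltW.
have hp := @normc_horner_le p n x spq x1.
apply: le_trans hp _; apply: (@le_trans _ _ (e * (c * x ^+ n.+1))); last first.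
  by rewrite ler_wpM2l // ltW.
rewrite exprS !mulrA ler_wpM2r ?exprn_ge0 ?(ltW x0) //.
have ec : 0 < e * c by rewrite mulr_gt0.
rewrite mulrC -ler_pdivrMr //; near: x; exact: ev_ge.
Unshelve. all: by end_near. Qed.

Lemma small_ratfun f : small f -> ratfun f.
Proof.
move=> [p [q [spq hf]]]; exists p, q; split=> //.
by rewrite -size_poly_gt0 (leq_ltn_trans _ spq).
Qed.

Lemma ratfun_ext f g : (\forall x \near +oo_R, f x = g x) -> ratfun f -> ratfun g.
Proof.
move=> h [p [q [q0 hf]]]; exists p, q; split=> //.
by near=> x; have <- : f x = g x; near: x.
Unshelve. all: by end_near. Qed.

Lemma small_ext f g : (\forall x \near +oo_R, f x = g x) -> small f -> small g.
Proof.
move=> h [p [q [q0 hf]]]; exists p, q; split=> //.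
by near=> x; have <- : f x = g x; near: x.
Unshelve. all: by end_near. Qed.

Lemma ratfun_poly p : ratfun (fun x => p.[x%:C]).
Proof.
by exists p, 1; split; [exact: oner_neq0 | near=> x; rewrite hornerC divr1].
Unshelve. all: by end_near. Qed.

Lemma small0 : small (fun=> 0).
Proof.
exists 0, 1; split; first by rewrite size_poly0 size_poly1.
by near=> x; rewrite horner0 mul0r.
Unshelve. all: by end_near. Qed.

Lemma ratfunM f g : ratfun f -> ratfun g -> ratfun (fun x => f x * g x).
Proof.
move=> [p [q [q0 hf]]] [p' [q' [q0' hg]]]; exists (p * p'), (q * q').
split; first by rewrite mulf_neq0.
near=> x.
have -> : f x = p.[x%:C] / q.[x%:C] by near: x.
have -> : g x = p'.[x%:C] / q'.[x%:C] by near: x.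
by rewrite !hornerM invfM mulrACA.
Unshelve. all: by end_near. Qed.

Lemma ratfunV f : ratfun f -> ratfun (fun x => (f x)^-1).
Proof.
move=> [p [q [q0 hf]]]; have [p0|p0] := eqVneq p 0.
  exists 0, 1; split; first exact: oner_neq0.
  near=> x; have -> : f x = p.[x%:C] / q.[x%:C] by near: x.
  by rewrite p0 horner0 !mul0r invr0.
exists q, p; split=> //; near=> x.
have -> : f x = p.[x%:C] / q.[x%:C] by near: x.
by rewrite invfM invrK mulrC.
Unshelve. all: by end_near. Qed.

Lemma ltn_pred_addn (a b c d : nat) :
  (0 < a -> a < c -> b < d -> (a + b).-1 < (c + d).-1)%N.
Proof. lia. Qed.

Lemma ltn_addl_pred (a b c : nat) : (0 < c -> a < b -> (c + a).-1 < (c + b).-1)%N.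
Proof. lia. Qed.

Lemma smallM f g : small f -> small g -> small (fun x => f x * g x).
Proof.
move=> [p [q [spq hf]]] [p' [q' [spq' hg]]]; exists (p * p'), (q * q'); split.
  have [p0|p0] := eqVneq p 0.
    rewrite p0 mul0r size_poly0 size_poly_gt0 mulf_neq0 // -size_poly_gt0;
    by [rewrite (leq_ltn_trans _ spq) | rewrite (leq_ltn_trans _ spq')].
  have q0 : q != 0 by rewrite -size_poly_gt0 (leq_ltn_trans _ spq).
  have q0' : q' != 0 by rewrite -size_poly_gt0 (leq_ltn_trans _ spq').
  apply: leq_ltn_trans (size_polyMleq _ _) _; rewrite size_mul //.
  rewrite -size_poly_gt0 in p0; exact: (ltn_pred_addn p0 spq spq').
near=> x.
have -> : f x = p.[x%:C] / q.[x%:C] by near: x.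
have -> : g x = p'.[x%:C] / q'.[x%:C] by near: x.
by rewrite !hornerM invfM mulrACA.
Unshelve. all: by end_near. Qed.

Lemma smallD f g : small f -> small g -> small (fun x => f x + g x).
Proof.
move=> [p [q [spq hf]]] [p' [q' [spq' hg]]].
have q0 : q != 0 by rewrite -size_poly_gt0 (leq_ltn_trans _ spq).
have q0' : q' != 0 by rewrite -size_poly_gt0 (leq_ltn_trans _ spq').
have hq := ev_horner_neq0 q0; have hq' := ev_horner_neq0 q0'.
exists (p * q' + p' * q), (q * q'); split.
  apply: leq_ltn_trans (size_polyD _ _) _; rewrite gtn_max (size_mul q0 q0').
  rewrite -!size_poly_gt0 in q0 q0'.
  apply/andP; split; apply: leq_ltn_trans (size_polyMleq _ _) _.
    by rewrite addnC (addnC (size q)) ltn_addl_pred.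
  by rewrite addnC ltn_addl_pred.
near=> x.
have -> : f x = p.[x%:C] / q.[x%:C] by near: x.
have -> : g x = p'.[x%:C] / q'.[x%:C] by near: x.
rewrite hornerD !hornerM; field; apply/andP; split; near: x; assumption.
Unshelve. all: by end_near. Qed.

Lemma small_cst_mul (c : R[i]) f : small f -> small (fun x => c * f x).
Proof.
move=> [p [q [spq hf]]]; exists (c *: p), q; split.
  by apply: leq_ltn_trans spq; exact: size_scale_leq.
near=> x; have -> : f x = p.[x%:C] / q.[x%:C] by near: x.
by rewrite hornerZ mulrA.
Unshelve. all: by end_near. Qed.

Lemma smallN f : small f -> small (fun x => - f x).
Proof.
move=> /(small_cst_mul (-1)); apply: small_ext; near=> x; by rewrite mulN1r.
Unshelve. all: by end_near. Qed.

Lemma smallB f g : small f -> small g -> small (fun x => f x - g x).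
Proof. by move=> hf hg; apply: smallD => //; exact: smallN. Qed.

Lemma small_sum (I : Type) (r : seq I) (F : I -> R -> R[i]) :
  (forall i, small (F i)) -> small (fun x => \sum_(i <- r) F i x).
Proof.
move=> h; elim: r => [|a r IH].
  by under eq_fun do rewrite big_nil; exact: small0.
by under eq_fun do rewrite big_cons; exact: smallD.
Qed.

Lemma small_inv_linear (c : R[i]) : small (fun x => (x%:C - c)^-1).
Proof.
exists 1, ('X - c%:P); split; first by rewrite size_poly1 size_XsubC.
by near=> x; rewrite !hornerE ?mul1r.
Unshelve. all: by end_near. Qed.

Lemma ev_cderiv_frac p q : q != 0 -> \forall x \near +oo_R,
  cderiv (fun y => p.[y%:C] / q.[y%:C]) x
    ((p^`() * q - p * q^`()).[x%:C] / (q * q).[x%:C]).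
Proof.
move=> q0; have hq := ev_horner_neq0 q0; near=> x.
have qx : q.[x%:C] != 0 by near: x.
apply: cderiv_eq (cderivM (cderiv_horner p x) (cderiv_inv qx (cderiv_horner q x))) _.
by rewrite hornerD hornerN !hornerM; field.
Unshelve. all: by end_near. Qed.

Lemma ratfun_derivable f : ratfun f -> ev_derivable f.
Proof.
move=> [p [q [q0 hf]]].
apply: (@ev_derivable_ext (fun y => p.[y%:C] / q.[y%:C])).
  by apply: filterS hf => x ->.
exact: ev_derivable_intro (ev_cderiv_frac p q0).
Qed.

Lemma ratfun_cD_eq f p q : q != 0 ->
  (\forall x \near +oo_R, f x = p.[x%:C] / q.[x%:C]) ->
  \forall x \near +oo_R, cD f x = (p^`() * q - p * q^`()).[x%:C] / (q * q).[x%:C].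
Proof.
move=> q0 hf; apply: ev_cderiv_eq; apply: ev_cderiv_ext (ev_cderiv_frac p q0).
by apply: filterS hf => x ->.
Qed.

Lemma small_cD f : small f -> small (cD f).
Proof.
move=> [p [q [spq hf]]].
have q0 : q != 0 by rewrite -size_poly_gt0 (leq_ltn_trans _ spq).
exists (p^`() * q - p * q^`()), (q * q); split; last exact: ratfun_cD_eq.
apply: leq_ltn_trans (size_polyD _ _) _; rewrite size_polyN gtn_max (size_mul q0 q0).
have hp' : (size p^`() <= size p)%N by apply: leq_trans (size_poly _ _) (leq_pred _).
have hq' : (size q^`() <= (size q).-1)%N by exact: size_poly.
rewrite -size_poly_gt0 in q0.
apply/andP; split; apply: leq_ltn_trans (size_polyMleq _ _) _.
  by rewrite [X in (X.-1 < _)%N]addnC; exact: (ltn_addl_pred q0 (leq_ltn_trans hp' spq)).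
move: hq' spq q0; move: (size p) (size q) (size q^`()) => a b c; lia.
Qed.

Lemma small_logderiv_poly p : p != 0 -> small (fun x => p^`().[x%:C] / p.[x%:C]).
Proof.
by move=> p0; exists p^`(), p; split; [exact: lt_size_deriv | near=> x].
Unshelve. all: by end_near. Qed.

Lemma ratfun_zero_or_neq0 f : ratfun f ->
  (\forall x \near +oo_R, f x = 0) \/ (\forall x \near +oo_R, f x != 0).
Proof.
move=> [p [q [q0 hf]]]; have [p0|p0] := eqVneq p 0; [left|right].
  by apply: filterS hf => x ->; rewrite p0 horner0 mul0r.
have hp := ev_horner_neq0 p0; have hq := ev_horner_neq0 q0; near=> x.
have -> : f x = p.[x%:C] / q.[x%:C] by near: x.
by rewrite mulf_neq0 ?invr_neq0 //; near: x.
Unshelve. all: by end_near. Qed.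

(** For [f = p / q] the logarithmic derivative is a difference of those of two polynomials, whose
    residues are multiplicities of roots, thus integers. *)
Lemma ratfun_logderiv f : ratfun f -> (\forall x \near +oo_R, f x != 0) ->
  exists p q, [/\ p != 0, q != 0 & \forall x \near +oo_R,
    cD f x / f x = p^`().[x%:C] / p.[x%:C] - q^`().[x%:C] / q.[x%:C]].
Proof.
move=> [p [q [q0 hf]]] f0; exists p, q.
have p0 : p != 0.
  apply/eqP => p0.
  have : \forall x \near +oo_R, False.
    near=> x; have : f x != 0 by near: x.
    have -> : f x = p.[x%:C] / q.[x%:C] by near: x.
    by rewrite p0 horner0 mul0r eqxx.
  by move/filter_ex => [].
split=> //.
have hd := ratfun_cD_eq q0 hf.
have hp := ev_horner_neq0 p0; have hq := ev_horner_neq0 q0; near=> x.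
have px : p.[x%:C] != 0 by near: x.
have qx : q.[x%:C] != 0 by near: x.
have -> : cD f x = (p^`() * q - p * q^`()).[x%:C] / (q * q).[x%:C] by near: x.
have -> : f x = p.[x%:C] / q.[x%:C] by near: x.
by rewrite hornerD hornerN !hornerM; field; rewrite px qx.
Unshelve. all: by end_near. Qed.

Lemma small_logderiv f : ratfun f -> (\forall x \near +oo_R, f x != 0) ->
  small (fun x => cD f x / f x).
Proof.
move=> rf f0; have [p [q [p0 q0 h]]] := ratfun_logderiv rf f0.
apply: small_ext (smallB (small_logderiv_poly p0) (small_logderiv_poly q0)).
by apply: filterS h => x ->.
Qed.

End RationalGerms.

(** * Differential equations with small coefficients for sums of exponential terms *)

Section SmallCombinations.
Variable R : realType.
Implicit Types (f g F G h : R -> R[i]) (x y : R).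

Definition smooth F := forall j, ev_derivable (iter j (@cD R) F).

(** With [f] the derivative of order [n] of [F], this is a linear differential equation of order [n]
    for [F] whose coefficients tend to 0 at infinity. *)
Definition comb (n : nat) F f := exists e : nat -> R -> R[i],
  (forall j, small (e j)) /\
  \forall x \near +oo_R, f x = \sum_(j < n) e j x * iter j (@cD R) F x.

Lemma comb_ext n F f g : (\forall x \near +oo_R, f x = g x) ->
  comb n F f -> comb n F g.
Proof.
move=> fg [e [se he]]; exists e; split=> //.
by near=> x; have <- : f x = g x; near: x.
Unshelve. all: by end_near. Qed.

Lemma combD n F f g : comb n F f -> comb n F g -> comb n F (fun x => f x + g x).
Proof.
move=> [e [se he]] [e' [se' he']]; exists (fun j x => e j x + e' j x); split.
  by move=> j; exact: smallD.
near=> x.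
have -> : f x = \sum_(j < n) e j x * iter j (@cD R) F x by near: x.
have -> : g x = \sum_(j < n) e' j x * iter j (@cD R) F x by near: x.
by rewrite -big_split; apply: eq_bigr => j _; rewrite mulrDl.
Unshelve. all: by end_near. Qed.

Lemma comb_smallM n F f h : small h -> comb n F f -> comb n F (fun x => h x * f x).
Proof.
move=> sh [e [se he]]; exists (fun j x => h x * e j x); split.
  by move=> j; exact: smallM.
apply: filterS he => x ->.
by rewrite mulr_sumr; apply: eq_bigr => j _; rewrite mulrA.
Qed.

Lemma combN n F f : comb n F f -> comb n F (fun x => - f x).
Proof.
move=> [e [se he]]; exists (fun j x => - e j x); split.
  by move=> j; exact: smallN.
apply: filterS he => x ->.
by rewrite -sumrN; apply: eq_bigr => j _; rewrite mulNr.
Qed.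

Lemma comb_zero n F : comb n F (fun=> 0).
Proof.
exists (fun _ _ => 0); split; first by move=> j; exact: small0.
by near=> x; rewrite big1 // => j _; rewrite mul0r.
Unshelve. all: by end_near. Qed.

Lemma comb_sum n m F (f : nat -> R -> R[i]) :
  (forall j, (j < m)%N -> comb n F (f j)) ->
  comb n F (fun x => \sum_(j < m) f j x).
Proof.
elim: m => [|m IH] h.
  by under eq_fun do rewrite big_ord0; exact: comb_zero.
under eq_fun do rewrite big_ord_recr.
by apply: combD; [apply: IH => j jm; apply: h; rewrite ltnS ltnW | exact: h].
Qed.

Lemma comb_term n F e j : small e -> (j < n)%N ->
  comb n F (fun x => e x * iter j (@cD R) F x).
Proof.
move=> se jn; exists (fun k => if k == j then e else fun=> 0); split.
  by move=> k; case: eqP => // _; exact: small0.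
near=> x; rewrite (bigD1 (Ordinal jn)) //= eqxx big1 ?addr0 // => k.
by rewrite -val_eqE /= => /negbTE ->; rewrite mul0r.
Unshelve. all: by end_near. Qed.

Lemma comb_widen n m F f : (n <= m)%N -> comb n F f -> comb m F f.
Proof.
move=> nm [e [se he]].
apply: (@comb_ext _ _ (fun x => \sum_(j < n) e j x * iter j (@cD R) F x)).
  by apply: filterS he => x ->.
apply: (@comb_sum _ _ _ (fun j x => e j x * iter j (@cD R) F x)) => j jn.
by apply: comb_term => //; exact: leq_trans nm.
Qed.

Lemma ev_cderiv_comb n F (e : nat -> R -> R[i]) : smooth F -> (forall j, small (e j)) ->
  \forall x \near +oo_R, cderiv (fun y => \sum_(j < n) e j y * iter j (@cD R) F y) x
    (\sum_(j < n) (cD (e j) x * iter j (@cD R) F x + e j x * iter j.+1 (@cD R) F x)).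
Proof.
move=> sF se.
have h : forall j : 'I_n, \forall x \near +oo_R,
    cderiv (e j) x (cD (e j) x) /\
    cderiv (iter j (@cD R) F) x (cD (iter j (@cD R) F) x).
  move=> j; apply: filterI; last exact: sF.
  exact/ratfun_derivable/small_ratfun.
apply: filterS (filter_forall _ h) => x hx.
apply: cderiv_sum => j; case: (hx j) => h1 h2.
exact: cderivM.
Qed.

Lemma comb_derivable n F f : smooth F -> comb n F f -> ev_derivable f.
Proof.
move=> sF [e [se he]].
apply: (@ev_derivable_ext _ (fun x => \sum_(j < n) e j x * iter j (@cD R) F x)).
  by apply: filterS he => x ->.
exact: ev_derivable_intro (ev_cderiv_comb n sF se).
Qed.

Lemma comb_cD n F f : smooth F -> comb n F f -> comb n.+1 F (cD f).
Proof.
move=> sF [e [se he]].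
have h : \forall x \near +oo_R, cD f x =
    \sum_(j < n) (cD (e j) x * iter j (@cD R) F x + e j x * iter j.+1 (@cD R) F x).
  apply: ev_cderiv_eq; apply: ev_cderiv_ext (ev_cderiv_comb n sF se).
  by apply: filterS he => x ->.
apply: (@comb_ext _ _ (fun x => \sum_(j < n)
    (cD (e j) x * iter j (@cD R) F x + e j x * iter j.+1 (@cD R) F x))).
  by apply: filterS h => x ->.
apply: (@comb_sum _ _ _ (fun j x =>
   cD (e j) x * iter j (@cD R) F x + e j x * iter j.+1 (@cD R) F x)) => j jn.
apply: combD; apply: comb_term => //; first exact: small_cD.
by rewrite ltnS ltnW.
Qed.

Lemma smoothD F G : smooth F -> smooth G -> smooth (fun x => F x + G x).
Proof.
move=> sF sG.
have h : forall j, \forall x \near +oo_R,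
   iter j (@cD R) F x + iter j (@cD R) G x = iter j (@cD R) (fun x => F x + G x) x.
  elim=> [|j IH] /=; first by near=> x.
  have hd : \forall x \near +oo_R, cderiv (fun x => iter j (@cD R) F x + iter j (@cD R) G x) x
     (cD (iter j (@cD R) F) x + cD (iter j (@cD R) G) x).
    near=> x; apply: cderivD; near: x; [exact: sF | exact: sG].
  have := ev_cderiv_eq (ev_cderiv_ext IH hd); apply: filterS => x ->//.
move=> j; apply: ev_derivable_ext (h j) _.
apply: (@ev_derivable_intro _ _ (fun x => cD (iter j (@cD R) F) x + cD (iter j (@cD R) G) x)).
by near=> x; apply: cderivD; near: x; [exact: sF | exact: sG].
Unshelve. all: by end_near. Qed.

Lemma smooth_zero : smooth (fun=> 0).
Proof.
have h : forall j, iter j (@cD R) (fun=> 0) = (fun=> 0).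
  by elim=> //= j ->; apply/funext => x; exact: cderiv_cD (cderiv_cst 0 x).
move=> j; rewrite h; apply: (@ev_derivable_intro _ _ (fun=> 0)).
by near=> x; exact: cderiv_cst.
Unshelve. all: by end_near. Qed.

(** By induction every derivative of [g] of positive order is [q g] with [q] small: the next factor
    is [q' + q h]. *)
Lemma smooth_exponential g h : small h ->
  (\forall x \near +oo_R, cderiv g x (h x * g x)) -> smooth g.
Proof.
move=> sh hg.
have dg : ev_derivable g by exact: ev_derivable_intro hg.
have H : forall j, exists2 q, small q &
    \forall x \near +oo_R, q x * g x = iter j.+1 (@cD R) g x.
  elim=> [|j [q sq IH]].
    by exists h => //; have := ev_cderiv_eq hg; apply: filterS => x /= ->.
  exists (fun x => cD q x + q x * h x).
    by apply: smallD; [exact: small_cD | exact: smallM].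
  have dq := ratfun_derivable (small_ratfun sq).
  have hd : \forall x \near +oo_R, cderiv (fun x => q x * g x) x
      ((cD q x + q x * h x) * g x).
    near=> x.
    have h1 : cderiv q x (cD q x) by near: x.
    have h2 : cderiv g x (h x * g x) by near: x.
    by apply: cderiv_eq (cderivM h1 h2) _; ring.
  have := ev_cderiv_eq (ev_cderiv_ext IH hd); apply: filterS => x /= ->//.
case=> [//|j]; have [q sq hq] := H j.
apply: ev_derivable_ext hq _.
apply: (@ev_derivable_intro _ _ (fun x => (cD q x + q x * h x) * g x)).
have dq := ratfun_derivable (small_ratfun sq).
near=> x.
have h1 : cderiv q x (cD q x) by near: x.
have h2 : cderiv g x (h x * g x) by near: x.
by apply: cderiv_eq (cderivM h1 h2) _; ring.
Unshelve. all: by end_near. Qed.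

(** When [G = F' - h F] is differentiated repeatedly, [h] and its derivatives stay small, so [G^(j)]
    is [F^(j+1)] up to a small combination of [F, ..., F^(j)]. *)
Lemma twist_comb F h : smooth F -> small h -> forall j,
  comb j.+1 F (fun x => iter j (@cD R) (fun y => cD F y - h y * F y) x
                         - iter j.+1 (@cD R) F x) /\
  ev_derivable (iter j (@cD R) (fun y => cD F y - h y * F y)).
Proof.
move=> sF sh; set G := fun y => _.
have key : forall j, comb j.+1 F (fun x => iter j (@cD R) G x - iter j.+1 (@cD R) F x) ->
    \forall x \near +oo_R, cderiv (iter j (@cD R) G) x
      (cD (fun x => iter j (@cD R) G x - iter j.+1 (@cD R) F x) x + iter j.+2 (@cD R) F x).
  move=> j hj; have dj := comb_derivable sF hj; have dF := sF j.+1.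
  apply: (@ev_cderiv_ext _ (fun x => (iter j (@cD R) G x - iter j.+1 (@cD R) F x)
      + iter j.+1 (@cD R) F x)); first by near=> x; rewrite subrK.
  by near=> x; apply: cderivD; near: x.
have main : forall j, comb j.+1 F (fun x => iter j (@cD R) G x - iter j.+1 (@cD R) F x).
  elim=> [|j IH].
    apply: (@comb_ext _ _ (fun x => - h x * iter 0 (@cD R) F x)).
      by near=> x; rewrite /G /= mulNr addrC addKr.
    by apply: comb_term => //; exact: smallN.
  apply: comb_ext (comb_cD sF IH).
  have := ev_cderiv_eq (key j IH); apply: filterS => x /= ->.
  by rewrite addrK.
move=> j; split; first exact: main.
exact: ev_derivable_intro (key j (main j)).
Unshelve. all: by end_near. Qed.

(* Induction on the number of terms: [F' - h_0 F] is the sum of the terms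
   [(h_k - h_0) g_k], whose logarithmic derivatives are changed only by those of
   the rational functions [h_k - h_0]. *)
Lemma exponential_sum_ode (I : eqType) (s : seq I) : forall (g h : I -> R -> R[i]) F,
  uniq s ->
  (forall k, k \in s -> [/\ small (h k), \forall x \near +oo_R, g k x != 0 &
     \forall x \near +oo_R, cderiv (g k) x (h k x * g k x)]) ->
  (forall k l, k \in s -> l \in s -> k != l -> ~ exists w, [/\ ratfun w,
     \forall x \near +oo_R, w x != 0 &
     \forall x \near +oo_R, cD w x = (h k x - h l x) * w x]) ->
  smooth F -> (\forall x \near +oo_R, F x = \sum_(k <- s) g k x) ->
  comb (size s) F (iter (size s) (@cD R) F) /\
  ((0 < size s)%N -> \forall x \near +oo_R,
     exists2 j, (j < size s)%N & iter j (@cD R) F x != 0).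
Proof.
elim: s => [|k0 s IH] g h F us hs ineq sF hF.
  split=> //; exists (fun _ _ => 0); split; first by move=> j; exact: small0.
  by apply: filterS hF => x /= ->; rewrite big_nil big_ord0.
have [sh0 g0 dg0] := hs k0 (mem_head _ _).
have k0s : k0 \notin s by case/andP: us.
pose c k x := h k x - h k0 x.
have hs' k : k \in s -> [/\ small (h k), \forall x \near +oo_R, g k x != 0 &
     \forall x \near +oo_R, cderiv (g k) x (h k x * g k x)].
  by move=> ks; apply: hs; rewrite inE ks orbT.
have sc k : k \in s -> small (c k) by move=> /hs'[sk _ _]; exact: smallB.
have c0 k : k \in s -> \forall x \near +oo_R, c k x != 0.
  (* If [h k - h k0] vanished near infinity, the constant 1 would be a rational solution of the kind
     that [ineq] excludes. *)
  move=> ks; have [z|//] := ratfun_zero_or_neq0 (small_ratfun (sc k ks)).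
  exfalso; apply: (ineq k k0); rewrite ?mem_head ?inE ?ks ?orbT //.
    by apply: contraNneq k0s => <-.
  exists (fun=> 1); split.
  - by apply: ratfun_ext (ratfun_poly 1); near=> x; rewrite hornerC.
  - by near=> x; exact: oner_neq0.
  - apply: filterS z => x; rewrite /c => ->.
    by rewrite (cderiv_cD (cderiv_cst 1 x)) mul0r.
pose g' k x := c k x * g k x.
pose h' k x := h k x + cD (c k) x / c k x.
pose G x := cD F x - h k0 x * F x.
have tw := twist_comb sF sh0.
have sG : smooth G by move=> j; case: (tw j).
have dgs : forall k, k \in k0 :: s ->
   \forall x \near +oo_R, cderiv (g k) x (h k x * g k x).
  by move=> k /hs[].
have hdF : \forall x \near +oo_R, cD F x = \sum_(k <- k0 :: s) h k x * g k x.
  apply: ev_cderiv_eq.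
  apply: (@ev_cderiv_ext _ (fun x => \sum_(k <- k0 :: s) g k x)).
    by apply: filterS hF => x ->.
  elim: (k0 :: s) dgs => [|k t IHt] dgs.
    near=> x; rewrite big_nil; under eq_fun do rewrite big_nil; exact: cderiv_cst.
  have h1 := dgs k (mem_head _ _).
  have h2 := IHt (fun l lt => dgs l (mem_behead (s := k :: t) lt)).
  near=> x; rewrite big_cons; under eq_fun do rewrite big_cons.
  by apply: cderivD; near: x.
have hG : \forall x \near +oo_R, G x = \sum_(k <- s) g' k x.
  near=> x; rewrite /G.
  have -> : cD F x = \sum_(k <- k0 :: s) h k x * g k x by near: x.
  have -> : F x = \sum_(k <- k0 :: s) g k x by near: x.
  rewrite !big_cons mulrDr opprD addrACA subrr add0r mulr_sumr -sumrB.
  by apply: eq_bigr => k _; rewrite /g' /c mulrBl.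
have [|||[e [se he]] hnz] := IH g' h' G _ _ _ sG hG.
- by case/andP: us.
- move=> k ks; have [sk gk dgk] := hs' k ks; have ck := c0 k ks; have sck := sc k ks.
  have dc := ratfun_derivable (small_ratfun sck); split.
  + by apply: smallD => //; apply: small_logderiv => //; exact: small_ratfun.
  + by near=> x; rewrite mulf_neq0 //; near: x.
  + near=> x.
    have h1 : cderiv (g k) x (h k x * g k x) by near: x.
    have h2 : cderiv (c k) x (cD (c k) x) by near: x.
    have h3 : c k x != 0 by near: x.
    by apply: cderiv_eq (cderivM h2 h1) _; rewrite /h' /g'; field.
- move=> k l ks ls kl [y [ry y0 hy]]; apply: (ineq k l) => //; rewrite ?inE ?ks ?ls ?orbT //.
  have ck := c0 k ks; have cl := c0 l ls.
  have rck := small_ratfun (sc k ks); have rcl := small_ratfun (sc l ls).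
  have dck := ratfun_derivable rck; have dcl := ratfun_derivable rcl.
  have dy := ratfun_derivable ry.
  (* The quotient [c l / c k] undoes the change from [h] to [h'], so a relation between two new
     terms would give one between the old ones. *)
  exists (fun x => y x * (c l x * (c k x)^-1)); split.
  + by apply: ratfunM => //; apply: ratfunM => //; exact: ratfunV.
  + by near=> x; rewrite !mulf_neq0 ?invr_neq0 //; near: x.
  + apply: ev_cderiv_eq; near=> x.
    have h1 : cderiv y x (cD y x) by near: x.
    have h2 : cderiv (c l) x (cD (c l) x) by near: x.
    have h3 : cderiv (c k) x (cD (c k) x) by near: x.
    have h4 : c k x != 0 by near: x.
    have h5 : c l x != 0 by near: x.
    have h6 : cD y x = (h' k x - h' l x) * y x by near: x.
    apply: cderiv_eq (cderivM h1 (cderivM h2 (cderiv_inv h4 h3))) _.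
    by rewrite h6 /h'; field; rewrite h4 h5.
have twj j : comb j.+1 F (fun x => iter j (@cD R) G x - iter j.+1 (@cD R) F x).
  by case: (tw j).
split; last first.
  move=> _ /=; have [s0|s0] := posnP (size s).
    near=> x; exists 0%N => //=.
    have -> : F x = \sum_(k <- k0 :: s) g k x by near: x.
    by rewrite big_cons (size0nil s0) big_nil addr0; near: x.
  (* Where [F, ..., F^(j)] all vanish, the small combination drops out and [G^(j) = F^(j+1)]; hence
     a vanishing jet of [F] would give a vanishing jet of [G]. *)
  have hall : forall j : 'I_(size s), \forall x \near +oo_R,
      (forall l, (l < j.+1)%N -> iter l (@cD R) F x = 0) ->
      iter j (@cD R) G x = iter j.+1 (@cD R) F x.
    move=> j; have [e' [_ he']] := twj j; apply: filterS he' => x hx z.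
    apply/eqP; rewrite -subr_eq0 hx big1 // => l _.
    by rewrite z ?mulr0.
  have hall' : \forall x \near +oo_R, forall j : 'I_(size s),
      (forall l, (l < j.+1)%N -> iter l (@cD R) F x = 0) ->
      iter j (@cD R) G x = iter j.+1 (@cD R) F x by exact: filter_forall hall.
  have hz := hnz s0; near=> x.
  apply: contrapT => hx.
  have z l : (l < (size s).+1)%N -> iter l (@cD R) F x = 0.
    by move=> ls; have [//|nz] := eqVneq (iter l (@cD R) F x) 0; case: hx; exists l.
  have [j js] : exists2 j, (j < size s)%N & iter j (@cD R) G x != 0 by near: x.
  have hx' : forall j : 'I_(size s), (forall l, (l < j.+1)%N -> iter l (@cD R) F x = 0) ->
      iter j (@cD R) G x = iter j.+1 (@cD R) F x by near: x.
  rewrite (hx' (Ordinal js)) /=; last by move=> l lj; apply: z; exact: (leq_trans lj (leqW js)).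
  by rewrite [cD _ x](z j.+1) ?eqxx.
(* In the equation for [G] every derivative of [G] is replaced by one of [F] plus a small
   combination; the order rises by one. *)
have cG : comb (size s).+1 F (iter (size s) (@cD R) G).
  apply: (@comb_ext _ _ (fun x => \sum_(j < size s) e j x * iter j (@cD R) G x)).
    by apply: filterS he => x ->.
  apply: (@comb_sum _ _ _ (fun j x => e j x * iter j (@cD R) G x)) => j js.
  apply: (@comb_ext _ _ (fun x => e j x * iter j.+1 (@cD R) F x +
      e j x * (iter j (@cD R) G x - iter j.+1 (@cD R) F x))).
    by near=> x; rewrite -mulrDr addrC subrK.
  apply: combD; first exact: comb_term.
  apply: comb_smallM => //; apply: comb_widen (twj j); exact: ltnW.
apply: comb_ext (combD cG (combN (twj (size s)))).
by near=> x; rewrite opprB addrC subrK.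
Unshelve. all: by end_near. Qed.

End SmallCombinations.

(** * Zeros and bounds for iterated derivatives of real functions *)

Section IteratedRolle.
Variable R : realType.
Implicit Types (x y : R).

Lemma is_derive_within_continuous (f df : R -> R) (a b : R) :
  (forall x, a <= x <= b -> is_derive x 1 f (df x)) ->
  {within `[a, b], continuous f}.
Proof.
move=> h; apply: derivable_within_continuous => x; rewrite in_itv /= => xab.
by have [] := h x xab.
Qed.

(** Here [f j.+1] is the derivative of [f j]. Rolle's theorem between neighbouring zeros costs one
    zero per derivation, so [f j] keeps an increasing family of [m - j] zeros. *)
Lemma iterated_rolle (f : nat -> R -> R) (a b : R) (m : nat) (t : nat -> R) :
  (forall j x, (j < m)%N -> a <= x <= b -> is_derive x 1 (f j) (f j.+1 x)) ->
  (forall i, (i < m)%N -> a <= t i <= b /\ f 0%N (t i) = 0) ->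
  (forall i, (i.+1 < m)%N -> t i < t i.+1) ->
  forall j, (j < m)%N -> exists2 x, a <= x <= b & f j x = 0.
Proof.
move=> hd h0 ht j jm.
suff [t' [h1 _]] : exists t' : nat -> R,
    (forall i, (i + j < m)%N -> a <= t' i <= b /\ f j (t' i) = 0) /\
    (forall i, (i.+1 + j < m)%N -> t' i < t' i.+1).
  by have [h2 h3] := h1 0%N jm; exists (t' 0%N).
elim: j jm => [|j IH] jm.
  by exists t; split=> i; rewrite addn0; [exact: h0 | exact: ht].
have [t' [h1 h2]] := IH (ltnW jm).
(* The condition on [i] is placed under the existential, with 0 as default, so that [choice] yields
   a sequence. *)
have hc : forall i, exists c, (i + j.+1 < m)%N -> t' i < c < t' i.+1 /\ f j.+1 c = 0.
  move=> i; have [im|im] := boolP (i + j.+1 < m)%N; last by exists 0.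
  have i1 : (i.+1 + j < m)%N by rewrite addSnnS.
  have tt := h2 i i1.
  have [/andP[a1 b1] f1] := h1 i (ltnW i1).
  have [/andP[a2 b2] f2] := h1 i.+1 i1.
  have hin x : t' i <= x <= t' i.+1 -> a <= x <= b.
    by move=> /andP[x1 x2]; rewrite (le_trans a1 x1) (le_trans x2 b2).
  have [||c] := @Rolle R (f j) (t' i) (t' i.+1) tt _ _ (etrans f1 (esym f2)).
  - move=> x; rewrite in_itv /= => /andP[x1 x2].
    by have [] := hd j x (ltnW jm) (hin x _); rewrite ?(ltW x1) ?(ltW x2).
  - by apply: (@is_derive_within_continuous _ (f j.+1)) => x /hin; exact: hd (ltnW jm).
  rewrite in_itv /= => cc [_ c0]; exists c => _; split=> //.
  have [_ <-//] : is_derive c 1 (f j) (f j.+1 c).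
  by apply: hd; [exact: ltnW | apply/hin; case/andP: cc => c1 c2; rewrite !ltW].
have [c hc'] := choice hc; exists c; split=> i im.
  have [/andP[c1 c2] fc] := hc' i im; split=> //.
  have i1 : (i.+1 + j < m)%N by rewrite addSnnS.
  have [/andP[a1 _] _] := h1 i (ltnW i1).
  have [/andP[_ b2] _] := h1 i.+1 i1.
  by rewrite (le_trans a1 (ltW c1)) (le_trans (ltW c2) b2).
have [/andP[_ c2] _] := hc' i (ltnW im).
by have [/andP[c1 _] _] := hc' i.+1 im; exact: lt_trans c1.
Qed.

Lemma bound_from_zero (f df : R -> R) (a b B z : R) :
  (forall x, a <= x <= b -> is_derive x 1 f (df x)) ->
  (forall x, a <= x <= b -> `|df x| <= B) ->
  a <= z <= b -> f z = 0 -> forall x, a <= x <= b -> `|f x| <= (b - a) * B.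
Proof.
move=> hd hB /andP[z1 z2] fz x /andP[x1 x2].
have ab : 0 <= b - a by rewrite subr_ge0 (le_trans z1).
have B0 : 0 <= B by apply: le_trans (normr_ge0 _) (hB z _); rewrite z1 z2.
have main (p q : R) : a <= p -> p < q -> q <= b -> `|f q - f p| <= (b - a) * B.
  move=> ap pq qb.
  have hin y : p <= y <= q -> a <= y <= b.
    by move=> /andP[y1 y2]; rewrite (le_trans ap y1) (le_trans y2 qb).
  have [||c] := @MVT R f df p q pq.
  - by move=> y; rewrite in_itv /= => /andP[y1 y2]; apply/hd/hin; rewrite !ltW.
  - by apply: (@is_derive_within_continuous _ df) => y /hin; exact: hd.
  rewrite in_itv /= => /andP[c1 c2] ->; rewrite normrM mulrC.
  apply: ler_pM => //; last by apply/hB/hin; rewrite !ltW.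
  by rewrite ger0_norm ?subr_ge0 ?(ltW pq) // lerB.
have [xz|zx|xz] := ltgtP x z.
- by have := main x z x1 xz z2; rewrite fz sub0r normrN.
- by have := main z x z1 zx x2; rewrite fz subr0.
- by rewrite xz fz normr0 mulr_ge0.
Qed.

End IteratedRolle.

(** * Rigidity: enough consecutive zeros far out force a vanishing jet *)

Section RigidZeros.
Variable R : realType.
Implicit Types (F : R -> R[i]) (x M : R).

(* On an interval of length [n], Rolle's theorem applied to the real and
   imaginary parts bounds every [F^(j)], [j < n], by a multiple of [sup |F^(n)|];
   the differential equation bounds [F^(n)] by a small multiple of the lower
   derivatives, so that the supremum vanishes. *)
Lemma consecutive_zeros n F : smooth F -> comb n F (iter n (@cD R) F) ->
  \forall M \near +oo_R, (forall i, (i < n)%N -> F (M + i%:R) = 0) ->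
    forall j, (j < n)%N -> iter j (@cD R) F M = 0.
Proof.
move=> sF [e [se he]]; have [->|n0] := posnP n; first by near=> M.
(* Passing from a bound on [F^(j+1)] to one on [F^(j)] costs a factor [2 n]: [n] for the length of
   the interval and 2 for the real and imaginary parts. [K] is the cost of [n] passages, and [eps]
   below satisfies [n eps K = 1/2]. *)
set K : R := (2 * n%:R) ^+ n.
have n1 : 1 <= n%:R :> R by rewrite ler1n.
have K0 : 0 < K by rewrite exprn_gt0 // mulr_gt0 // ltr0n.
pose eps : R := (2 * (n%:R * K))^-1.
have eps0 : 0 < eps by rewrite invr_gt0 !mulr_gt0 // ltr0n.
have hall : \forall x \near +oo_R, forall j : 'I_n, normc (e j x) <= eps.
  by apply: filter_forall => j; exact: small_cvg0.
have hder : \forall x \near +oo_R, forall j : 'I_n.+1,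
    cderiv (iter j (@cD R) F) x (iter j.+1 (@cD R) F x).
  by apply: filter_forall => j; exact: sF.
have [A [_ hA]] := filterI he (filterI hall hder).
exists A; split; first exact: num_real.
move=> M AM hz.
pose b := M + n%:R.
have hI x : M <= x <= b -> iter n (@cD R) F x = \sum_(j < n) e j x * iter j (@cD R) F x /\
   ((forall j : 'I_n, normc (e j x) <= eps) /\
    forall j : 'I_n.+1, cderiv (iter j (@cD R) F) x (iter j.+1 (@cD R) F x)).
  by move=> /andP[Mx _]; apply: hA; exact: lt_le_trans Mx.
have hdj j x : (j <= n)%N -> M <= x <= b ->
    cderiv (iter j (@cD R) F) x (iter j.+1 (@cD R) F x).
  by move=> jn /hI[_ [_ h]]; exact: (h (Ordinal (jn : j < n.+1)%N)).
have MIb : M <= M <= b by rewrite lexx /b lerDl ler0n.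
have bM : b - M = n%:R by rewrite /b addrC addKr.
have zP (P : R[i] -> R) : P 0 = 0 ->
   (forall j x, (j <= n)%N -> M <= x <= b ->
      is_derive x 1 (fun y => P (iter j (@cD R) F y)) (P (iter j.+1 (@cD R) F x))) ->
   forall j, (j < n)%N -> exists2 x, M <= x <= b & P (iter j (@cD R) F x) = 0.
  move=> P0 hP j jn.
  apply: (@iterated_rolle _ (fun j y => P (iter j (@cD R) F y)) M b n (fun i => M + i%:R)) => //.
  - by move=> k x kn; apply: hP; exact: ltnW.
  - move=> i i_n; rewrite /= hz // P0; split=> //.
    by rewrite lerDl ler0n /= lerD2l ler_nat ltnW.
  - by move=> i i_n; rewrite ltrD2l ltr_nat.
have dRe j x : (j <= n)%N -> M <= x <= b -> is_derive x 1
    (fun y => Re (iter j (@cD R) F y)) (Re (iter j.+1 (@cD R) F x)).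
  by move=> jn xI; case: (hdj j x jn xI).
have dIm j x : (j <= n)%N -> M <= x <= b -> is_derive x 1
    (fun y => Im (iter j (@cD R) F y)) (Im (iter j.+1 (@cD R) F x)).
  by move=> jn xI; case: (hdj j x jn xI).
have step j B : (j < n)%N ->
    (forall x, M <= x <= b -> normc (iter j.+1 (@cD R) F x) <= B) ->
    forall x, M <= x <= b -> normc (iter j (@cD R) F x) <= 2 * n%:R * B.
  move=> jn hB x xI.
  have [zr zrI zr0] := zP (@complex.Re R) erefl dRe j jn.
  have [zi ziI zi0] := zP (@complex.Im R) erefl dIm j jn.
  have br := bound_from_zero (fun y => dRe j y (ltnW jn))
    (fun y yI => le_trans (normc_ge_Re_abs _) (hB y yI)) zrI zr0 xI.
  have bi := bound_from_zero (fun y => dIm j y (ltnW jn))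
    (fun y yI => le_trans (normc_ge_Im_abs _) (hB y yI)) ziI zi0 xI.
  rewrite bM in br bi.
  apply: le_trans (normc_le_ReIm _) _; apply: le_trans (lerD br bi) _.
  by rewrite -mulrA mulr2n mulrDl !mul1r.
have bound B k : 0 <= B -> (k <= n)%N ->
    (forall x, M <= x <= b -> normc (iter n (@cD R) F x) <= B) ->
    forall x, M <= x <= b -> normc (iter (n - k) (@cD R) F x) <= (2 * n%:R) ^+ k * B.
  move=> B0; elim: k => [|k IH] kn hB x xI.
    by rewrite subn0 expr0 mul1r; exact: hB.
  rewrite exprS -mulrA; apply: step => //; first by rewrite ltn_subrL n0.
  by rewrite -subSn // subSS => y yI; apply: IH => //; exact: ltnW.
have [c cI hc] : exists2 c, M <= c <= b & forall x, M <= x <= b ->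
    normc (iter n (@cD R) F x) <= normc (iter n (@cD R) F c).
  pose S x := Re (iter n (@cD R) F x) * Re (iter n (@cD R) F x) +
    Im (iter n (@cD R) F x) * Im (iter n (@cD R) F x).
  have [|c] := @EVT_max R S M b (le_trans (andP MIb).1 (andP MIb).2).
    apply: derivable_within_continuous => x; rewrite in_itv /= => xI.
    have hr := dRe n x (leqnn n) xI; have hi := dIm n x (leqnn n) xI.
    by have [] := is_deriveD (is_deriveM hr hr) (is_deriveM hi hi).
  rewrite in_itv /= => cI hc; exists c => // x xI.
  rewrite -ler_sqr ?nnegrE ?normc_ge0 // !sqr_normcE !expr2; apply: hc.
  by rewrite in_itv.
set B := normc (iter n (@cD R) F c) in hc.
have B0 : 0 <= B by exact: normc_ge0.
have low j x : (j < n)%N -> M <= x <= b -> normc (iter j (@cD R) F x) <= K * B.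
  move=> jn xI.
  have -> : j = (n - (n - j))%N by rewrite subKn // ltnW.
  apply: le_trans (bound B (n - j)%N B0 (leq_subr _ _) hc x xI) _.
  rewrite ler_wpM2r // ler_weXn2l ?leq_subr //; lra.
(* The equation at the maximum point [c] has [n] terms, each at most [eps K B]; hence
   [B <= n eps K B = B / 2]. *)
have half : B <= B / 2.
  have [eF [he' _]] := hI c cI.
  rewrite {1}/B eF; apply: le_trans (normc_sum _ _) _.
  apply: (@le_trans _ _ (\sum_(j < n) eps * (K * B))).
    apply: ler_sum => j _; rewrite normcM; apply: ler_pM; rewrite ?normc_ge0 //.
    exact: low.
  rewrite sumr_const card_ord -[_ *+ n]mulr_natr.
  have -> : eps * (K * B) * n%:R = B / 2.
    have n2 : n%:R != 0 :> R by rewrite pnatr_eq0 -lt0n.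
    by rewrite /eps; field; rewrite (lt0r_neq0 K0) n2.
  by [].
have {half}B00 : B = 0 by lra.
move=> j jn; apply: eq0_normc; apply/eqP; rewrite eq_le normc_ge0 andbT.
by have := low j M jn MIb; rewrite B00 mulr0.
Unshelve. all: by end_near. Qed.

End RigidZeros.

(** * Residues of sums of simple fractions *)

Section Residues.
Variable R : realType.
Implicit Types (f g : R -> R[i]) (x : R) (p q : {poly R[i]}) (v w : R[i]).

Lemma ev_root_eq0 p : (\forall x \near +oo_R, p.[x%:C] = 0) -> p = 0.
Proof.
move=> h; apply/eqP; apply: contraT => /ev_horner_neq0 h'.
have : \forall x \near +oo_R, False.
  near=> x; have : p.[x%:C] != 0 by near: x.
  have -> : p.[x%:C] = 0 by near: x.
  by rewrite eqxx.
by move/filter_ex => [].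
Unshelve. all: by end_near. Qed.

(** Entries of [L] are pairs of a coefficient and a pole, and poles may repeat. Multiplying by one
    factor per distinct pole gives a polynomial [P] that vanishes for all large [x], hence
    identically; its value at a pole [v] is the residue there times a nonzero product. *)
Lemma residue_eq0 (L : seq (R[i] * R[i])) :
  (\forall x \near +oo_R, \sum_(t <- L) t.1 / (x%:C - t.2) = 0) ->
  forall v, \sum_(t <- L | t.2 == v) t.1 = 0.
Proof.
move=> h v; have [vL|vL] := boolP (v \in map snd L); last first.
  rewrite big_seq_cond big_pred0 // => t; apply/negP => /andP[tL /eqP tv].
  by case/negP: vL; rewrite -tv; apply/mapP; exists t.
pose V := undup (map snd L).
pose P := \sum_(t <- L) t.1 *: \prod_(w <- V | w != t.2) ('X - w%:P).
have PE z : P.[z] = \sum_(t <- L) t.1 * \prod_(w <- V | w != t.2) (z - w).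
  rewrite horner_sum; apply: eq_bigr => t _; rewrite hornerZ horner_prod.
  by congr (_ * _); apply: eq_bigr => w _; rewrite !hornerE.
have hV : \forall x \near +oo_R, (\prod_(w <- V) ('X - w%:P)).[x%:C] != 0.
  by apply: ev_horner_neq0; rewrite -size_poly_gt0 size_prod_XsubC.
have P0 : P = 0.
  apply: ev_root_eq0; near=> x; rewrite PE.
  have : (\prod_(w <- V) ('X - w%:P)).[x%:C] != 0 by near: x.
  rewrite horner_prod prodf_seq_neq0 => /allP hx.
  have hs : \sum_(t <- L) t.1 / (x%:C - t.2) = 0 by near: x.
  transitivity (\prod_(w <- V) (x%:C - w) * \sum_(t <- L) t.1 / (x%:C - t.2)); last first.
    by rewrite hs mulr0.
  rewrite mulr_sumr.
  apply: eq_big_seq => t tL.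
  have tV : t.2 \in V by rewrite mem_undup; apply/mapP; exists t.
  rewrite [in RHS](bigD1_seq t.2) ?undup_uniq //=.
  have := hx _ tV; rewrite !hornerE => xt.
  set Q := \prod_(_ <- _ | _) _.
  rewrite -[RHS]/((x%:C - t.2) * Q * t.1 / (x%:C - t.2)).
  by clearbody Q; field.
have := PE v; rewrite P0 horner0 (bigID (fun t => t.2 == v)) /=.
rewrite [X in _ = _ + X]big1 ?addr0; last first.
  move=> t tv; rewrite (_ : \prod_(_ <- _ | _) _ = 0) ?mulr0 //.
  apply/eqP; rewrite prodf_seq_eq0; apply/hasP; exists v; rewrite ?mem_undup //.
  by rewrite subrr eqxx eq_sym tv.
rewrite (eq_bigr (fun t => t.1 * \prod_(w <- V | w != v) (v - w))); last first.
  by move=> t /eqP ->.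
rewrite -mulr_suml => /esym/eqP; rewrite mulf_eq0 => /orP[/eqP //|].
rewrite prodf_seq_eq0 => /hasP[w _ /andP[wv]].
by rewrite subr_eq0 eq_sym (negbTE wv).
Unshelve. all: by end_near. Qed.

Definition is_int v := exists m : int, v = m%:~R.

Lemma is_int0 : is_int 0. Proof. by exists 0. Qed.

Lemma is_intD v w : is_int v -> is_int w -> is_int (v + w).
Proof. by move=> [m ->] [n ->]; exists (m + n); rewrite intrD. Qed.

Lemma is_intN v : is_int v -> is_int (- v).
Proof. by move=> [m ->]; exists (- m); rewrite mulrNz. Qed.

Lemma is_int_sum (I : Type) (r : seq I) (P : pred I) (F : I -> R[i]) :
  (forall i, P i -> is_int (F i)) -> is_int (\sum_(i <- r | P i) F i).
Proof.
by move=> h; elim/big_ind : _ => //; [exact: is_int0 | exact: is_intD].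
Qed.

(* Germs of logarithmic derivatives of rational functions. *)
Definition int_simple_poles f := exists L : seq (int * R[i]),
  \forall x \near +oo_R, f x = \sum_(t <- L) t.1%:~R / (x%:C - t.2).

Lemma int_simple_polesD f g : int_simple_poles f -> int_simple_poles g ->
  int_simple_poles (fun x => f x + g x).
Proof.
move=> [L hL] [L' hL']; exists (L ++ L'); near=> x; rewrite big_cat /=.
by congr (_ + _); near: x.
Unshelve. all: by end_near. Qed.

Lemma int_simple_polesN f : int_simple_poles f -> int_simple_poles (fun x => - f x).
Proof.
move=> [L hL]; exists [seq (- t.1, t.2) | t <- L]; apply: filterS hL => x ->.
by rewrite big_map -sumrN; apply: eq_bigr => t _; rewrite /= mulrNz mulNr.
Qed.

Lemma int_simple_polesB f g : int_simple_poles f -> int_simple_poles g ->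
  int_simple_poles (fun x => f x - g x).
Proof. by move=> hf hg; apply: int_simple_polesD => //; exact: int_simple_polesN. Qed.

Lemma int_simple_poles_ext f g : (\forall x \near +oo_R, f x = g x) ->
  int_simple_poles f -> int_simple_poles g.
Proof.
move=> h [L hL]; exists L; near=> x; have <- : f x = g x by near: x.
by near: x.
Unshelve. all: by end_near. Qed.

(** Each root, listed as often as its multiplicity, contributes that many fractions with coefficient
    1. *)
Lemma int_simple_poles_logderiv p : p != 0 ->
  int_simple_poles (fun x => p^`().[x%:C] / p.[x%:C]).
Proof.
move=> p0; have [rs hp] := closed_field_poly_normal p.
have c0 : lead_coef p != 0 by rewrite lead_coef_eq0.
exists [seq (1, r) | r <- rs].
have hn := ev_horner_neq0 p0; near=> x.
have : p.[x%:C] != 0 by near: x.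
rewrite hp derivZ !hornerZ; set c := lead_coef p in c0 *.
rewrite mulf_eq0 (negbTE c0) orFb => hx.
rewrite invfM mulrACA mulfV // mul1r big_map.
elim: (rs) hx => [|r t IH]; first by rewrite !big_nil derivC horner0 mul0r.
rewrite !big_cons derivM derivXsubC mul1r !hornerE mulf_eq0 negb_or => /andP[h1 h2].
rewrite -(IH h2) /=.
by move: h1 h2; move: (_.[x%:C]) (x%:C - r) (_^`().[x%:C]) => a b c' b0 a0; field; rewrite a0 b0.
Unshelve. all: by end_near. Qed.

End Residues.

(** * From integral residues to integral exponents *)

Section Integrality.
Variables (R : realType) (s : nat) (u alpha : 'I_s -> R[i]).
Hypothesis u_inj : injective u.
Implicit Types (x : R) (v w : R[i]).

(** The logarithmic derivative of [ratio_prod k] below; [x + j - u i] is written [x - (u i - j)] to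
    display the poles. *)
Definition log_ratio (k : nat) x : R[i] :=
  \sum_(j < k) \sum_(i < s) alpha i / (x%:C - (u i - j%:R)).

(** As [u] is injective, the sum has at most one term. In this form the residue of [log_ratio k] at
    [v] is the sum of [exponent_at (v + j)] over [j < k]. *)
Definition exponent_at w : R[i] := \sum_(i < s | u i == w) alpha i.

Lemma exponent_at_u i : exponent_at (u i) = alpha i.
Proof.
rewrite /exponent_at (bigD1 i) //= big1 ?addr0 // => j /andP[/eqP/u_inj ->].
by rewrite eqxx.
Qed.

(** The pole [u i - j] sits at [v] exactly when [u i = v + j]. Once the fractions with integer
    coefficients are moved to the other side, [residue_eq0] equates the sum with a sum of
    integers. *)
Lemma log_ratio_residue (l k : nat) : (l <= k)%N ->
  int_simple_poles (fun x => log_ratio k x - log_ratio l x) ->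
  forall v, is_int (\sum_(l <= j < k) exponent_at (v + j%:R)).
Proof.
move=> lk [L hL] v.
pose L1 := [seq (alpha t.2, u t.2 - (t.1)%:R : R[i]) |
   t <- [seq (j, i) | j <- index_iota l k, i <- index_enum 'I_s]].
pose L2 := [seq (- ((t.1)%:~R : R[i]), t.2) | t <- L].
have h : \forall x \near +oo_R, \sum_(t <- L1 ++ L2) t.1 / (x%:C - t.2) = 0.
  apply: filterS hL => x hx; rewrite big_cat /= [X in _ + X]big_map /=.
  under [X in _ + X]eq_bigr do rewrite mulNr.
  rewrite sumrN -hx big_map big_allpairs /=; apply/eqP; rewrite subr_eq0; apply/eqP.
  rewrite /log_ratio -!(big_mkord xpredT (fun j => \sum_(i < s) alpha i / (x%:C - (u i - j%:R)))).
  rewrite (big_cat_nat (leq0n l) lk) /=.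
  by rewrite [RHS]addrAC subrr add0r.
have := residue_eq0 h v; rewrite big_cat /= [X in _ + X]big_map /= sumrN.
move/eqP; rewrite subr_eq0 => /eqP e.
have -> : \sum_(l <= j < k) exponent_at (v + j%:R) = \sum_(t <- L1 | t.2 == v) t.1.
  rewrite big_map [RHS]big_mkcond big_allpairs /=; apply: eq_bigr => j _.
  rewrite /exponent_at big_mkcond; apply: eq_bigr => i _.
  by rewrite subr_eq.
by rewrite e; apply: is_int_sum => t _; exists t.1.
Qed.

(** Multiples of [m] eventually carry [w] to the right of all the finitely many [u i]. *)
Lemma exponent_at_far w m : (0 < m)%N -> exists N : nat, exponent_at (w + (m * N)%:R) = 0.
Proof.
move=> m0; pose B := \sum_(i < s) `|Re (u i)| + `|Re w| + 1.
exists (Num.bound B); rewrite /exponent_at big_pred0 // => i; apply/negP => /eqP e.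
have hB : B < (Num.bound B)%:R.
  by apply: archi_boundP; rewrite !addr_ge0 // sumr_ge0.
have := congr1 (@complex.Re R) e; rewrite Re_add Re_nat => e'.
have h1 : `|Re (u i)| <= \sum_(i < s) `|Re (u i)|.
  by rewrite (bigD1 i) //= lerDl sumr_ge0.
have h2 : (Num.bound B)%:R <= (m * Num.bound B)%:R :> R by rewrite ler_nat leq_pmull.
have h3 := ler_norm (Re (u i)); have h4 : - Re w <= `|Re w| by rewrite -normrN ler_norm.
move: hB; rewrite {1}/B; lra.
Qed.

(* The difference of the residues at [w - l] and [w - l + 1] is
   [exponent_at (w + (k - l)) - exponent_at w]. *)
Lemma alpha_int_of_poles (l k : nat) : (l < k)%N ->
  int_simple_poles (fun x => log_ratio k x - log_ratio l x) ->
  forall i, is_int (alpha i).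
Proof.
move=> lk hp i; have hS := log_ratio_residue (ltnW lk) hp.
have m0 : (0 < k - l)%N by rewrite subn_gt0.
have per w : is_int (exponent_at (w + (k - l)%:R) - exponent_at w).
  have h1 := hS (w - l%:R); have h2 := hS (w - l%:R + 1).
  have := is_intD h2 (is_intN h1).
  have -> : \sum_(l <= j < k) exponent_at (w - l%:R + 1 + j%:R) =
     \sum_(l <= j < k) exponent_at (w - l%:R + j.+1%:R).
    by apply: eq_bigr => j _; rewrite -addrA nat1r.
  rewrite -sumrB (telescope_sumr (fun j : nat => exponent_at (w - l%:R + j%:R))) ?(ltnW lk) //.
  by rewrite subrK -addrA [- _ + _]addrC -natrB // ltnW.
(* Starting at [u i], steps of length [k - l] change the exponent by integers only, until it is
   0. *)
have perN N : is_int (exponent_at (u i + ((k - l) * N)%:R) - exponent_at (u i)).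
  elim: N => [|N IH]; first by rewrite muln0 addr0 subrr; exact: is_int0.
  have := is_intD (per (u i + ((k - l) * N)%:R)) IH.
  by rewrite addrA subrK -addrA -natrD mulnS [(k - l + _)%N]addnC.
have [N hN] := exponent_at_far (u i) m0.
have := is_intN (perN N); rewrite hN sub0r opprK exponent_at_u //.
Qed.

End Integrality.

(** * Crossings of the cut of the logarithm by the values of Gamma *)

Section BranchJumps.
Variable R : realType.
Implicit Types (u : R[i]).

(** For [n > Re u], this happens when the sum of the two arguments leaves ]-pi, pi]. Otherwise
    passing from [n] to [n.+1] multiplies the power [alpha] of Gamma by
    [cexp (alpha * clog (n - u))]. *)
Definition gamma_jump u (n : nat) : Prop :=
  clog (Gamma (n.+1%:R - u)) <> clog (n%:R - u) + clog (Gamma (n%:R - u)).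

Lemma Re_nat_sub_gt0 u (n : nat) : Re u < n%:R -> 0 < Re (n%:R - u).
Proof. by rewrite Re_add Re_opp Re_nat subr_gt0. Qed.

Lemma Gamma_natS u (n : nat) : Re u < n%:R ->
  Gamma (n.+1%:R - u) = (n%:R - u) * Gamma (n%:R - u).
Proof.
move=> /Re_nat_sub_gt0 h; rewrite -GammaD1 //; congr Gamma.
by rewrite -natr1 addrAC.
Qed.

Lemma Re_gt0_neq0 (z : R[i]) : 0 < Re z -> z != 0.
Proof. by move=> h; apply/eqP => e; rewrite e ltxx in h. Qed.

Lemma carg_nat_sub_small u (e : R) : 0 < e -> exists N : nat, forall n, (N <= n)%N ->
  Re u < n%:R /\ `|carg (n%:R - u)| <= e.
Proof.
move=> e0; case: u => a b.
(* For [|y| <= 1] one has [|atan y| <= |y| + y^2 <= 2 |y|], whence the bounds 1 and [e / 2]. *)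
pose eta := Num.min 1 (e / 2).
have eta0 : 0 < eta by rewrite lt_min ltr01 divr_gt0.
pose B := `|a| + `|b| / eta + 1.
have B0 : 0 <= B by rewrite !addr_ge0 // divr_ge0 // ltW.
exists (Num.bound B) => n hn.
have nB : B < n%:R by apply: lt_le_trans (archi_boundP B0) _; rewrite ler_nat.
have ha := ler_norm a.
have hb : 0 <= `|b| / eta by rewrite divr_ge0 // ltW.
have na : `|b| / eta < n%:R - a by move: nB; rewrite /B; lra.
have na0 : 0 < n%:R - a by exact: le_lt_trans na.
split=> /=; first by rewrite -subr_gt0.
rewrite carg_atan ?Re_nat_sub_gt0 //=; last by rewrite -subr_gt0.
rewrite nat_complex /=; set y := (0 - b) / (n%:R - a).
have hy : `|y| <= eta.
  rewrite /y sub0r mulNr normrN normrM normfV (gtr0_norm na0) ler_pdivrMr //.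
  by rewrite mulrC -ler_pdivrMr // ltW.
have h1 : eta <= 1 by rewrite ge_min lexx.
have h2 : eta <= e / 2 by rewrite ge_min lexx orbT.
have h3 : `|y| ^+ 2 <= `|y|.
  by rewrite expr2 ler_piMr // (le_trans hy).
have h4 := atan_sub_bound y; rewrite -real_normK ?num_real // in h4.
have : `|atan y| <= `|atan y - y| + `|y| by rewrite -{1}(subrK y (atan y)) ler_normD.
lra.
Qed.

Lemma carg_nat_sub_sign u (n : nat) : Re u < n%:R ->
  (0 <= carg (n%:R - u)) = (Im u <= 0).
Proof.
move=> h; have h0 := Re_nat_sub_gt0 h; rewrite carg_atan // Im_add Im_opp Im_nat.
rewrite sub0r; apply/idP/idP => [|i0].
  apply: contraTT; rewrite -!ltNge => i0; rewrite -[0]atan0 lt_atan //.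
  by rewrite mulNr oppr_lt0 divr_gt0.
by rewrite -[0]atan0 le_atan // divr_ge0 ?oppr_ge0 // ltW.
Qed.

(* After a jump [carg (Gamma (n - u))] starts from one end of ]-pi, pi] and moves
   towards the other end by steps of size at most [pi / T.+1]. *)
Lemma gamma_jump_rare u (T : nat) : exists N : nat, forall n, (N <= n)%N ->
  forall t, (0 < t <= T)%N -> gamma_jump u n -> ~ gamma_jump u (n + t)%N.
Proof.
have pi0 := pi_gt0 R.
have T0 : 0 < T.+1%:R :> R by rewrite ltr0n.
have e0 : 0 < pi / T.+1%:R :> R by rewrite divr_gt0.
have [N hN] := carg_nat_sub_small u e0; exists N => n nN t /andP[t0 tT] jn.
set e : R := pi / T.+1%:R in e0 hN.
have Te : T.+1%:R * e = pi by rewrite /e mulrC divfK // gt_eqF.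
pose G m := Gamma (m%:R - u); pose d m := carg (m%:R - u).
have Re_u m : (n <= m)%N -> Re u < m%:R by move=> nm; case: (hN m (leq_trans nN nm)).
have d_e m : (n <= m)%N -> `|d m| <= e by move=> nm; case: (hN m (leq_trans nN nm)).
have G0 m : (n <= m)%N -> G m != 0 by move=> /Re_u/Re_nat_sub_gt0; exact: Gamma_neq0.
have z0 m : (n <= m)%N -> (m%:R - u : R[i]) != 0.
  by move=> /Re_u/Re_nat_sub_gt0; exact: Re_gt0_neq0.
have GS m : (n <= m)%N -> G m.+1 = (m%:R - u) * G m by move=> /Re_u; exact: Gamma_natS.
have nojump m : (n <= m)%N -> - pi < d m + carg (G m) <= pi ->
    clog (G m.+1) = clog (m%:R - u) + clog (G m).
  by move=> nm h; rewrite GS // clog_mul ?z0 ?G0.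
have argS m : (n <= m)%N -> - pi < d m + carg (G m) <= pi ->
    carg (G m.+1) = d m + carg (G m).
  by move=> nm h; have := congr1 (@complex.Im R) (nojump m nm h); rewrite Im_add.
have arg_b m : (n <= m)%N -> - pi < carg (G m) <= pi by move=> /G0; exact: carg_bound.
have hte k : (k <= T)%N -> k.+1%:R * e <= pi.
  by move=> kT; rewrite -Te ler_pM2r // ler_nat.
have := d_e n (leqnn n); rewrite ler_norml => /andP[dn1 dn2].
have /andP[b1 b2] := arg_b n (leqnn n).
have wrapn : ~~ (- pi < d n + carg (G n) <= pi).
  by apply/negP => h; apply: jn; exact: (nojump n (leqnn n)).
have sgn m : (n <= m)%N -> (0 <= d m) = (Im u <= 0) by move=> /Re_u; exact: carg_nat_sub_sign.
(* For [Im u <= 0] the steps [d m] are nonnegative, so a jump can only leave through the upper end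
   [pi]. *)
have [iu|iu] := leP (Im u) 0.
  have dpos m : (n <= m)%N -> 0 <= d m by move=> nm; rewrite sgn.
  have dn := dpos n (leqnn n).
  have hw : pi < d n + carg (G n).
    move: wrapn; rewrite negb_and -!ltNge -leNgt => /orP[h|//]; lra.
  (* The jump leaves the argument at most [- pi + e], and each later step adds at most [e]. As
     [T.+1 * e = pi], the upper end stays out of reach for [T] steps. *)
  have key k : (k < T.+1)%N -> carg (G (n + k.+1)%N) <= - pi + k.+1%:R * e.
    elim: k => [|k IH] kT.
      rewrite addn1 GS // carg_mul_wrap ?z0 ?G0 // mulr2n -/(d n); lra.
    have nk : (n <= n + k.+1)%N by rewrite leq_addr.
    have {}IH := IH (ltnW kT); have := d_e _ nk; rewrite ler_norml => /andP[_ d2].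
    have /andP[a1 a2] := arg_b _ nk; have d1 := dpos _ nk.
    have hk := hte k.+1 kT.
    have hk1 : k.+2%:R * e = k.+1%:R * e + e by rewrite -natr1 mulrDl mul1r.
    rewrite addnS argS //; last by apply/andP; split; lra.
    by lra.
  apply; case: t t0 tT => // k _ kT.
  have nk : (n <= n + k.+1)%N by rewrite leq_addr.
  have {}key := key k (ltnW kT); have := d_e _ nk; rewrite ler_norml => /andP[_ d2].
  have /andP[a1 a2] := arg_b _ nk; have d1 := dpos _ nk.
  have hk := hte k.+1 kT.
  have hk1 : k.+2%:R * e = k.+1%:R * e + e by rewrite -natr1 mulrDl mul1r.
  by apply: (nojump _ nk); apply/andP; split; lra.
(* The mirror case: the steps are negative and a jump leaves through the lower end. *)
have dneg m : (n <= m)%N -> d m < 0.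
  by move=> nm; rewrite ltNge sgn // -ltNge.
have dn := dneg n (leqnn n).
have hw : d n + carg (G n) <= - pi.
  move: wrapn; rewrite negb_and -leNgt -ltNge => /orP[//|h]; lra.
have key k : (k < T.+1)%N -> pi - k.+1%:R * e <= carg (G (n + k.+1)%N).
  elim: k => [|k IH] kT.
    rewrite addn1 GS // carg_mul_wrapN ?z0 ?G0 // mulr2n -/(d n); lra.
  have nk : (n <= n + k.+1)%N by rewrite leq_addr.
  have {}IH := IH (ltnW kT); have := d_e _ nk; rewrite ler_norml => /andP[d2 _].
  have /andP[a1 a2] := arg_b _ nk; have d1 := dneg _ nk.
  have hk := hte k.+1 kT.
  have hk1 : k.+2%:R * e = k.+1%:R * e + e by rewrite -natr1 mulrDl mul1r.
  rewrite addnS argS //; last by apply/andP; split; lra.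
  by lra.
apply; case: t t0 tT => // k _ kT.
have nk : (n <= n + k.+1)%N by rewrite leq_addr.
have {}key := key k (ltnW kT); have := d_e _ nk; rewrite ler_norml => /andP[d2 _].
have /andP[a1 a2] := arg_b _ nk; have d1 := dneg _ nk.
have hk := hte k.+1 kT.
have hk1 : k.+2%:R * e = k.+1%:R * e + e by rewrite -natr1 mulrDl mul1r.
by apply: (nojump _ nk); apply/andP; split; lra.
Qed.

(* Among [s.+1] consecutive windows, the [s] factors can spoil at most [s]. *)
Lemma jump_free_window (s : nat) (u : 'I_s -> R[i]) (W M0 : nat) :
  exists M : nat, (M0 <= M)%N /\ forall i n, (M <= n < M + W)%N -> ~ gamma_jump (u i) n.
Proof.
(* The span [s.+1 * W] covers all the windows together, so no factor jumps in two of them. *)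
have [N hN] := choice (fun i => gamma_jump_rare (u i) (s.+1 * W)%N).
pose M1 := maxn M0 (\max_(i < s) N i).
have [h|h] := pselect (exists j : 'I_s.+1, forall i n,
    (M1 + j * W <= n < M1 + j * W + W)%N -> ~ gamma_jump (u i) n).
  case: h => j hj; exists (M1 + j * W)%N; split=> //.
  by apply: leq_trans (leq_addr _ _); exact: leq_maxl.
have bad (j : 'I_s.+1) : exists q : 'I_s * nat,
    (M1 + j * W <= q.2 < M1 + j * W + W)%N /\ gamma_jump (u q.1) q.2.
  apply: contrapT => hq; apply: h; exists j => i n hn hj.
  by apply: hq; exists (i, n).
have [q hq] := choice bad.
(* Pigeonhole: with [s.+1] spoiled windows and [s] factors, one factor spoils two windows. *)
have : ~~ injectiveb (fun j => (q j).1).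
  apply/negP => /injectiveP /leq_card; rewrite !card_ord ltnn //.
move=> /injectivePn[j [j' jj' e]]; exfalso.
wlog lt : j j' jj' e / (j < j')%N.
  move=> hw; have [l|l|l] := ltngtP j j'; first exact: (hw j j').
    by apply: (hw j' j) => //; rewrite eq_sym.
  by move/eqP: jj'; apply; exact: val_inj.
have [/andP[a1 a2] b] := hq j; have [/andP[a1' a2'] b'] := hq j'.
have jW : (j * W + W <= j' * W)%N by rewrite addnC -mulSn leq_mul2r lt orbT.
have jsW : (j' * W + W <= s.+1 * W)%N by rewrite addnC -mulSn leq_mul2r ltn_ord orbT.
have lt2 : ((q j).2 < (q j').2)%N.
  by apply: leq_trans a2 (leq_trans _ a1'); rewrite -addnA leq_add2l.
have := hN (q j).1 (q j).2 _ ((q j').2 - (q j).2)%N _ b.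
rewrite subnKC ?(ltnW lt2) // e; apply => //.
  apply: leq_trans (leq_trans (leq_addr _ _) a1).
  by apply: leq_trans (leq_maxr _ _); exact: leq_bigmax.
rewrite subn_gt0 lt2 /=; move: a1 a2' jsW; move: (j * W)%N (j' * W)%N (s.+1 * W)%N => A B C.
lia.
Qed.

End BranchJumps.

(** * The two implications for products of powers of Gamma *)

Section HolonomicGamma.
Variables (R : realType) (s : nat) (u alpha : 'I_s -> R[i]).
Implicit Types (x : R).

Local Notation gamma_prod := (fun n : int =>
  \prod_(i < s) cpow (Gamma (n%:~R - u i)) (alpha i)).

(** The ratio of the terms of indices [x + k] and [x] in a window without jumps, extended to real
    [x]. *)
Definition ratio_prod (k : nat) x : R[i] :=
  \prod_(j < k) \prod_(i < s) cexp (alpha i * clog (x%:C - (u i - j%:R))).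

Lemma ev_gt_Re : \forall x \near +oo_R, forall i : 'I_s, Re (u i) < x.
Proof. by apply: filter_forall => i; exact: ev_gt. Qed.

Lemma ratio_prod_cderiv k : \forall x \near +oo_R,
  cderiv (ratio_prod k) x (log_ratio u alpha k x * ratio_prod k x).
Proof.
apply: filterS ev_gt_Re => x hx.
apply: (@cderiv_prod R _ _ _ (fun (j : 'I_k) x =>
  \sum_(i < s) alpha i / (x%:C - (u i - j%:R)))) => j.
apply: (@cderiv_prod R _ _ _ (fun (i : 'I_s) x => alpha i / (x%:C - (u i - j%:R)))) => i.
have h : Re (u i - j%:R) < x.
  rewrite Re_add Re_opp Re_nat; apply: le_lt_trans (hx i).
  by rewrite lerBlDr lerDl ler0n.
apply: cderiv_eq (cderiv_cexp (cderivM (cderiv_cst (alpha i) x) (cderiv_clog h))) _.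
by rewrite mul0r add0r.
Qed.

Lemma small_log_ratio k : small (log_ratio u alpha k).
Proof.
apply: (@small_sum R _ _ (fun (j : 'I_k) x =>
  \sum_(i < s) alpha i / (x%:C - (u i - j%:R)))) => j.
apply: (@small_sum R _ _ (fun (i : 'I_s) x => alpha i / (x%:C - (u i - j%:R)))) => i.
by apply: small_cst_mul; exact: small_inv_linear.
Qed.

Lemma ratio_prod_neq0 k x : ratio_prod k x != 0.
Proof. by apply/prodf_neq0 => j _; apply/prodf_neq0 => i _; exact: cexp_neq0. Qed.

Lemma gamma_prod_neq0 (n : nat) : (forall i, Re (u i) < n%:R) ->
  gamma_prod n%:Z != 0.
Proof.
move=> h; apply/prodf_neq0 => i _; rewrite -pmulrn cpow_cexp ?cexp_neq0 //.
by apply/Gamma_neq0/Re_nat_sub_gt0.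
Qed.

(** Without a jump at [m], [clog (Gamma (m + 1 - u i))] is
    [clog (m - u i) + clog (Gamma (m - u i))], so each unit step contributes one factor of
    [ratio_prod]. *)
Lemma gamma_prod_shift (n k : nat) : (forall i, Re (u i) < n%:R) ->
  (forall i m, (n <= m < n + k)%N -> ~ gamma_jump (u i) m) ->
  gamma_prod (n + k)%N%:Z = ratio_prod k n%:R * gamma_prod n%:Z.
Proof.
move=> hn; elim: k => [|k IH] hj.
  by rewrite addn0 /ratio_prod big_ord0 mul1r.
rewrite /ratio_prod big_ord_recr /= mulrAC -IH; last first.
  by move=> i m /andP[m1 m2]; apply: hj; rewrite m1 addnS ltnS ltnW.
rewrite -big_split /=; apply: eq_bigr => i _.
have hi (m : nat) : (n <= m)%N -> Re (u i) < m%:R.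
  by move=> nm; apply: lt_le_trans (hn i) _; rewrite ler_nat.
have g0 (m : nat) : (n <= m)%N -> Gamma (m%:R - u i) != 0.
  by move=> /hi/Re_nat_sub_gt0; exact: Gamma_neq0.
rewrite -!pmulrn !cpow_cexp ?g0 ?leq_addr // addnS -cexpD -mulrDr; congr (cexp (_ * _)).
have : ~ gamma_jump (u i) (n + k)%N by apply: hj; rewrite leq_addr addnS ltnS leqnn.
move/contrapT => ->; rewrite addrC; congr (_ + clog _).
by rewrite natrD -nat_complex opprB addrA addrAC.
Qed.

Lemma holonomic_alpha_int (n0 : int) : injective u ->
  holonomic n0 gamma_prod -> forall i, is_int (alpha i).
Proof.
move=> u_inj [d [p [[k0 pk0] [N [_ hrec]]]]]; apply: contrapT => nint.
(* Zero coefficients are discarded so that every remaining term has a logarithmic derivative. *)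
pose S := [seq k <- enum 'I_d.+1 | p k != 0].
have uS : uniq S by rewrite filter_uniq // enum_uniq.
have S0 : (0 < size S)%N.
  by rewrite -has_predT; apply/hasP; exists k0 => //; rewrite mem_filter pk0 mem_enum.
have Sd : (size S <= d.+1)%N.
  by rewrite size_filter (leq_trans (count_size _ _)) // size_enum_ord.
pose g (k : 'I_d.+1) x := (p k).[x%:C] * ratio_prod k x.
pose h (k : 'I_d.+1) x := (p k)^`().[x%:C] / (p k).[x%:C] + log_ratio u alpha k x.
pose F x := \sum_(k <- S) g k x.
have gS k : k \in S -> [/\ small (h k), \forall x \near +oo_R, g k x != 0 &
     \forall x \near +oo_R, cderiv (g k) x (h k x * g k x)].
  rewrite mem_filter => /andP[pk _].
  have hp := ev_horner_neq0 pk; have hr := ratio_prod_cderiv k; split.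
  - by apply: smallD; [exact: small_logderiv_poly | exact: small_log_ratio].
  - by apply: filterS hp => x px; rewrite mulf_neq0 // ratio_prod_neq0.
  - near=> x.
    have px : (p k).[x%:C] != 0 by near: x.
    have rx : cderiv (ratio_prod k) x (log_ratio u alpha k x * ratio_prod k x) by near: x.
    by apply: cderiv_eq (cderivM (cderiv_horner (p k) x) rx) _; rewrite /h /g; field.
have ineq k l : k \in S -> l \in S -> k != l -> ~ exists w, [/\ ratfun w,
     \forall x \near +oo_R, w x != 0 &
     \forall x \near +oo_R, cD w x = (h k x - h l x) * w x].
  (* The logarithmic derivatives of [w], [p k] and [p l] have simple poles with integer residues; so
     then does the difference of the two [log_ratio], which makes every [alpha i] an integer. *)
  rewrite !mem_filter => /andP[pk _] /andP[pl _] kl [w [rw w0 hw]]; apply: nint.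
  have [P [Q [P0 Q0 hPQ]]] := ratfun_logderiv rw w0.
  have hd : int_simple_poles (fun x => log_ratio u alpha k x - log_ratio u alpha l x).
    apply: (int_simple_poles_ext _ (int_simple_polesB
      (int_simple_polesB (int_simple_poles_logderiv P0) (int_simple_poles_logderiv Q0))
      (int_simple_polesB (int_simple_poles_logderiv pk) (int_simple_poles_logderiv pl)))).
    near=> x.
    have wx : w x != 0 by near: x.
    have <- : cD w x / w x = P^`().[x%:C] / P.[x%:C] - Q^`().[x%:C] / Q.[x%:C] by near: x.
    have -> : cD w x = (h k x - h l x) * w x by near: x.
    by rewrite mulfK // /h; ring.
  have [l_k|k_l|e] := ltngtP l k.
  - exact: (alpha_int_of_poles u_inj l_k hd).
  - apply: (alpha_int_of_poles u_inj k_l).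
    apply: int_simple_poles_ext (int_simple_polesN hd).
    by near=> x; rewrite opprB.
  - by case/eqP: kl; apply: val_inj.
have sF : smooth F.
  rewrite /F; elim: (S) gS => [|k t IH] gS.
    by under eq_fun do rewrite big_nil; exact: smooth_zero.
  under eq_fun do rewrite big_cons; apply: smoothD.
    by have [sh _ dg] := gS k (mem_head _ _); exact: smooth_exponential dg.
  by apply: IH => l lt; apply: gS; rewrite inE lt orbT.
have hF : \forall x \near +oo_R, F x = \sum_(k <- S) g k x by near=> x.
have [cF nzF] := exponential_sum_ode uS gS ineq sF hF.
have [A [_ hA]] := filterI (consecutive_zeros sF cF) (filterI (nzF S0) ev_gt_Re).
(* The recurrence is used at the indices [M + i] with [i < size S <= d.+1] and involves shifts up to
   [d], which fits in a window of length [d.+1 + d.+1]. The lower bound places [M] beyond both [A]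
   and [N]. *)
have [M [M0 hM]] := jump_free_window u (d.+1 + d.+1) (maxn (Num.bound `|A|) `|N|%N).
have AM : A < M%:R.
  apply: le_lt_trans (ler_norm A) _; apply: lt_le_trans (archi_boundP (normr_ge0 A)) _.
  by rewrite ler_nat (leq_trans _ M0) // leq_maxl.
have NM : N <= M%:Z.
  apply: le_trans (lez_abs N) _; by rewrite lez_nat (leq_trans _ M0) // leq_maxr.
have [zM [[j jS nz] uM]] := hA _ AM.
(* The jet of [F] at [M] is nonzero, yet it must vanish once [F] is zero at the points [M + i] with
   [i < size S]. *)
case/negP: nz; apply/eqP; apply: zM => // i iS.
have iM : M%:R + i%:R = (M + i)%N%:R :> R by rewrite natrD.
have un (m : nat) (l : 'I_s) : (M <= m)%N -> Re (u l) < m%:R.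
  by move=> Mm; apply: lt_le_trans (uM l) _; rewrite ler_nat.
have hN : N <= (M + i)%N%:Z by apply: le_trans NM _; rewrite lez_nat leq_addr.
have gn0 : gamma_prod (M + i)%N%:Z != 0.
  by apply: gamma_prod_neq0 => l; apply: un; rewrite leq_addr.
have := hrec _ hN.
(* Every term of the recurrence is a multiple of the term of index [M + i] of the sequence, which is
   nonzero; dividing by it leaves [F (M + i) = 0]. *)
rewrite (eq_bigr (fun k : 'I_d.+1 => g k (M + i)%N%:R * gamma_prod (M + i)%N%:Z)); last first.
  move=> k _; rewrite -PoszD gamma_prod_shift.
  - by rewrite mulrA /g -nat_complex -pmulrn.
  - by move=> l; apply: un; rewrite leq_addr.
  - move=> l m /andP[m1 m2]; apply: hM; rewrite (leq_trans (leq_addr i M) m1) /=.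
    apply: leq_trans m2 _; rewrite -addnA leq_add2l leq_add //.
      exact: leq_trans (ltnW iS) Sd.
    exact/ltnW/ltn_ord.
rewrite -mulr_suml => /eqP; rewrite mulf_eq0 (negbTE gn0) orbF => /eqP e.
rewrite iM /F big_filter big_enum_cond -[RHS]e big_mkcond /=; apply: eq_bigr => k _.
by case: ifPn => // /negbNE/eqP pk; rewrite /g pk horner0 mul0r.
Unshelve. all: by end_near. Qed.

(** For integer exponents the ratio of consecutive terms is a rational function [P / Q], where [P]
    collects the positive exponents and [Q] the negative ones. The recurrence
    [- P(n) a_n + Q(n) a_(n+1) = 0] holds from [n0] on, as every [n - u i] then has positive real
    part. *)
Lemma alpha_int_holonomic (n0 : int) : (forall i, Re (u i) < n0%:~R) ->
  (forall i, is_int (alpha i)) -> holonomic n0 gamma_prod.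
Proof.
move=> hn0 /choice[m hm].
pose mp i : nat := if 0 <= m i then `|m i|%N else 0%N.
pose mn i : nat := if 0 <= m i then 0%N else `|m i|%N.
have mE (z : R[i]) i : z != 0 -> z ^ m i * z ^+ mn i = z ^+ mp i.
  rewrite /mp /mn => z0; case: (m i) => k /=; first by rewrite expr0 mulr1.
  exact: (mulVf (expf_neq0 k.+1 z0)).
pose P := \prod_(i < s) ('X - (u i)%:P) ^+ mp i.
pose Q := \prod_(i < s) ('X - (u i)%:P) ^+ mn i.
exists 1%N, (fun k => if k == ord0 then - P else Q); split.
  exists ord_max => /=; apply/prodf_neq0 => i _.
  by rewrite expf_neq0 // polyXsubC_eq0.
exists n0; split=> // n hn.
have hu i : 0 < Re (n%:~R - u i).
  rewrite Re_add Re_opp int_complex /= subr_gt0; apply: lt_le_trans (hn0 i) _.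
  by rewrite ler_int.
rewrite big_ord_recl big_ord1 /= addr0 hornerN mulNr addrC; apply/eqP.
rewrite subr_eq0; apply/eqP; rewrite /P /Q !horner_prod -!big_split /=.
apply: eq_bigr => i _; rewrite !hornerE hm.
have z0 := Re_gt0_neq0 (hu i); have g0 := Gamma_neq0 (hu i).
have -> : (n + 1)%:~R - u i = n%:~R - u i + 1 by rewrite intrD addrAC.
rewrite GammaD1 // !cpow_int ?mulf_neq0 // exprzMl ?unitfE //.
by rewrite -(mE _ i z0); ring.
Qed.

End HolonomicGamma.

Theorem theorem8 (R : realType) (s : nat) (hs : (0 < s)%N)
    (u alpha : 'I_s -> R[i]) (u_inj : injective u) :
  let n0 : int :=
    Num.floor (\big[Num.max/complex.Re (u (Ordinal hs))]_(i < s)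
                 complex.Re (u i)) + 1 in
  let a : int -> R[i] :=
    fun n => \prod_(i < s) cpow (Gamma (n%:~R - u i)) (alpha i) in
  holonomic n0 a <-> (forall i : 'I_s, exists m : int, alpha i = m%:~R).
Proof.
move=> n0 a; split; first exact: holonomic_alpha_int.
apply: alpha_int_holonomic => i; rewrite /n0.
by apply: le_lt_trans (floorD1_gt _); exact: le_bigmax.
Qed.
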